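(* The Sierpiński carpet group $G$ is amenable and has Property FW.
   Context: The Sierpiński carpet group $G$ is the group of automorphisms of the rooted tree $\mathsf X^*$ of finite words over $\mathsf X=\{1,2,\dots,8\}$ generated by the four transformations $a,b,c,d$ defined recursively by $a=(12)(67)(1,1,a,1,a,1,1,a)$, $b=(46)(58)(b,b,b,1,1,1,1,1)$, $c=(23)(78)(c,1,1,c,1,c,1,1)$, $d=(14)(35)(1,1,1,1,1,d,d,d)$, where $g=\pi(g_1,\dots,g_8)$ with $\pi\in\mathrm{Sym}(8)$ means $g(xw)=\pi(x)\,g_x(w)$ for all $x\in\mathsf X$, $w\in\mathsf X^*$ (and an entry $1$ in a tuple is the identity). Property FW: for an action of $G$ on a set $Y$, a subset $A\subset Y$ is commensurated if $gA\triangle A$ is finite for all $g\in G$, and transfixed if it has finite symmetric difference with a $G$-invariant subset; $G$ has Property FW if every commensurated subset of every $G$-set is transfixed. *)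

(* Defs.v *)
From HB Require Import structures.
From mathcomp Require Import all_boot all_order all_algebra all_fingroup.
From mathcomp Require Import boolp classical_sets functions cardinality reals.

Set Implicit Arguments.
Unset Strict Implicit.
Unset Printing Implicit Defensive.

Import Order.TTheory GRing.Theory Num.Theory.
Local Open Scope classical_set_scope.
Local Open Scope group_scope.

Section TreeAut.
Variable X : finType.
Implicit Types (f g : seq X -> seq X) (u v w : seq X).

Definition tree_adj u v : bool :=
  [exists x : X, (v == rcons u x) || (u == rcons v x)].

Definition is_tree_aut f : Prop :=
  [/\ bijective f, f [::] = [::] &
      forall u v, tree_adj (f u) (f v) = tree_adj u v].

Record tree_aut := TreeAut {
  tree_aut_fun :> seq X -> seq X;
  tree_aut_funP : `[< is_tree_aut tree_aut_fun >] }.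

HB.instance Definition _ := [isSub for tree_aut_fun].
HB.instance Definition _ := gen_eqMixin tree_aut.
HB.instance Definition _ := gen_choiceMixin tree_aut.

Lemma tree_autP (g : tree_aut) : is_tree_aut g.
Proof. exact/asboolP/tree_aut_funP. Qed.

Lemma tree_aut_ext (g h : tree_aut) : (g : seq X -> seq X) =1 h -> g = h.
Proof. by move=> gh; apply: val_inj; apply: funext. Qed.

Lemma is_tree_aut_id : is_tree_aut id.
Proof. by split=> //; exists id. Qed.

Lemma is_tree_aut_comp f g :
  is_tree_aut f -> is_tree_aut g -> is_tree_aut (f \o g).
Proof.
move=> [fb f0 fa] [gb g0 ga]; split; first exact: bij_comp.
- by rewrite /= g0 f0.
- by move=> u v; rewrite /= fa ga.
Qed.

Lemma tree_aut_inv_ex (g : tree_aut) :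
  exists h : tree_aut, cancel g h /\ cancel h g.
Proof.
have [[h gK hK] g0 ga] := tree_autP g.
have hP : is_tree_aut h.
  split; first by exists g.
  - by rewrite -{1}g0 gK.
  - by move=> u v; rewrite -ga !hK.
by exists (TreeAut (introT (asboolP _) hP)).
Qed.

Definition tree_aut_one : tree_aut :=
  TreeAut (introT (asboolP _) is_tree_aut_id).

(* The action on words is a left action: [(g * h) w = g (h w)].  This differs
   from the product of [{perm T}]. *)
Definition tree_aut_mul (g h : tree_aut) : tree_aut :=
  TreeAut (introT (asboolP _) (is_tree_aut_comp (tree_autP g) (tree_autP h))).

Definition tree_aut_inv (g : tree_aut) : tree_aut :=
  projT1 (cid (tree_aut_inv_ex g)).

Lemma tree_aut_invK (g : tree_aut) :
  cancel g (tree_aut_inv g) /\ cancel (tree_aut_inv g) g.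
Proof. by rewrite /tree_aut_inv; case: cid. Qed.

Fact tree_aut_mulA : associative tree_aut_mul.
Proof. by move=> f g h; apply: tree_aut_ext. Qed.

Fact tree_aut_mul1 : left_id tree_aut_one tree_aut_mul.
Proof. by move=> g; apply: tree_aut_ext. Qed.

Fact tree_aut_mulr1 : right_id tree_aut_one tree_aut_mul.
Proof. by move=> g; apply: tree_aut_ext. Qed.

Fact tree_aut_mulV : left_inverse tree_aut_one tree_aut_inv tree_aut_mul.
Proof.
move=> g; apply: tree_aut_ext => w /=.
by have [gK _] := tree_aut_invK g; rewrite gK.
Qed.

Fact tree_aut_mulrV : right_inverse tree_aut_one tree_aut_inv tree_aut_mul.
Proof.
move=> g; apply: tree_aut_ext => w /=.
by have [_ gK] := tree_aut_invK g; rewrite gK.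
Qed.

HB.instance Definition _ := isGroup.Build tree_aut
  tree_aut_mulA tree_aut_mul1 tree_aut_mulr1 tree_aut_mulV tree_aut_mulrV.

(* The transformation [g = p (g_x)_x] such that [g_x = g] for [x \in S] and
   [g_x = 1] for [x \notin S], that is, [g (x :: w) = p x :: g_x w]. *)
Fixpoint rec_act (p : {perm X}) (S : {set X}) (w : seq X) : seq X :=
  if w is x :: v then p x :: (if x \in S then rec_act p S v else v) else [::].

Lemma rec_act_rcons p S w x :
  exists y, rec_act p S (rcons w x) = rcons (rec_act p S w) y.
Proof.
elim: w => [|z w [y IH]] /=; first by exists (p x); rewrite if_same.
by case: ifP => _; rewrite ?IH; [exists y | exists x].
Qed.

Lemma rec_act_inj p S : injective (rec_act p S).
Proof.
elim=> [|x u IH] [|y v] //= [/perm_inj <-].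
by case: ifP => _ => [/IH|] ->.
Qed.

Lemma rec_act_surj p S w : exists v, rec_act p S v = w.
Proof.
elim: w => [|y w [v IH]]; first by exists [::].
exists (p^-1 y :: if p^-1 y \in S then v else w) => /=.
by rewrite permKV; case: (_ \in S); rewrite ?IH.
Qed.

Lemma is_tree_aut_rec p S : is_tree_aut (rec_act p S).
Proof.
set f := rec_act p S; have f_inj : injective f := @rec_act_inj p S.
have fb : bijective f.
  have /choice [h hK] := @rec_act_surj p S.
  by exists h; [move=> w; apply: f_inj; apply: hK | apply: hK].
have frc u v : [exists x, f v == rcons (f u) x] = [exists x, v == rcons u x].
  apply/existsP/existsP => [[x /eqP E]|[x /eqP ->]]; last first.
    by have [y E] := rec_act_rcons p S u x; exists y; rewrite /f E.
  case/lastP: v E => [|v y]; first by move/(congr1 size); rewrite size_rcons.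
  have [z Ez] := rec_act_rcons p S v y.
  by rewrite /f Ez => /rcons_inj [/f_inj -> _]; exists y.
split=> // u v; have orE (P Q : pred X) :
  [exists x, P x || Q x] = [exists x, P x] || [exists x, Q x].
  apply/existsP/orP => [[x /orP[]]|[] /existsP[x Hx]].
  - by left; apply/existsP; exists x.
  - by right; apply/existsP; exists x.
  - by exists x; rewrite Hx.
  - by exists x; rewrite Hx orbT.
by rewrite /tree_adj !orE !frc.
Qed.

Definition rec_aut (p : {perm X}) (S : {set X}) : tree_aut :=
  TreeAut (introT (asboolP _) (is_tree_aut_rec p S)).

End TreeAut.

Section Generated.
Variables (G : groupType) (S : set G).

Definition generated : set G := smallest (fun H : set G => group_closed [in H]) S.

Definition gen_group := {g : G | g \in generated}.

HB.instance Definition _ := SubChoice.on gen_group.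

Fact generated_closed : group_closed [in generated].
Proof.
split; first by rewrite inE => H [[]]; rewrite inE.
move=> x y; rewrite !inE => xS yS H /[dup] HP [[_ HM] _].
by have := HM x y; rewrite !inE; apply; [apply: xS | apply: yS].
Qed.

HB.instance Definition _ :=
  SubChoice_isSubGroup.Build G [in generated] gen_group generated_closed.

End Generated.

(* Amenability of a discrete group in the sense of von Neumann.  The choice of
   [R] is immaterial, since all [realType]s are isomorphic. *)
Definition amenable (R : realType) (G : groupType) : Prop :=
  exists mu : set G -> R,
    [/\ forall A, (0 <= mu A)%R,
        mu setT = 1%R,
        forall A B, A `&` B = set0 -> mu (A `|` B) = (mu A + mu B)%R &
        forall g A, mu [set g * x | x in A] = mu A].

Section PropertyFW.
Variable G : groupType.

Definition is_left_action (Y : Type) (act : G -> Y -> Y) : Prop :=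
  (forall y, act 1 y = y) /\ (forall g h y, act (g * h) y = act g (act h y)).

Definition commensurated (Y : Type) (act : G -> Y -> Y) (A : set Y) : Prop :=
  forall g, finite_set ((act g @` A) `+` A).

Definition invariant_set (Y : Type) (act : G -> Y -> Y) (B : set Y) : Prop :=
  forall g, act g @` B = B.

Definition transfixed (Y : Type) (act : G -> Y -> Y) (A : set Y) : Prop :=
  exists B, invariant_set act B /\ finite_set (A `+` B).

Definition property_FW : Prop :=
  forall (Y : Type) (act : G -> Y -> Y), is_left_action act ->
  forall A : set Y, commensurated act A -> transfixed act A.

End PropertyFW.

(* The letters 1, ..., 8 are the elements 0, ..., 7 of ['I_8]. *)
Definition letter (k : nat) : 'I_8 := inord k.-1.

Definition swap (i j : nat) : {perm 'I_8} := tperm (letter i) (letter j).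

Definition carpet_a : tree_aut 'I_8 :=
  rec_aut (swap 1 2 * swap 6 7) [set letter 3; letter 5; letter 8].
Definition carpet_b : tree_aut 'I_8 :=
  rec_aut (swap 4 6 * swap 5 8) [set letter 1; letter 2; letter 3].
Definition carpet_c : tree_aut 'I_8 :=
  rec_aut (swap 2 3 * swap 7 8) [set letter 1; letter 4; letter 6].
Definition carpet_d : tree_aut 'I_8 :=
  rec_aut (swap 1 4 * swap 3 5) [set letter 6; letter 7; letter 8].

Definition carpet_group : groupType :=
  gen_group [set carpet_a; carpet_b; carpet_c; carpet_d].

(* Main.v *)
From HB Require Import structures.
From mathcomp Require Import all_boot all_order all_algebra all_fingroup.
From mathcomp Require Import boolp classical_sets functions cardinality reals.
From mathcomp Require Import filter ring lra zify.
Require Import Defs.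

(* Let [X] be the set of the eight letters.  Commutators such as
   [[(ab)^2, (bc)^2]] act on the first letter only, as 3-cycles.  It follows
   that the group [G] contains a copy of itself below every vertex of the tree
   and that [G] is the permutational wreath product of itself with a finite
   group of letter permutations.

   Property FW.  Let [A] be commensurated, and call an orbit of the copy of [G]
   below a vertex [v] bad if it meets both [A] and its complement in infinite
   sets; at each vertex there are finitely many bad orbits.  Any finite-index
   normal subgroup [K] of [G] contains the copies of [[G, G]] at some level,
   even as commutators of elements of [K].  Applied to the kernel of the action
   of one copy on the bad orbits of a commuting one, this shows that bad orbits
   at incomparable vertices are disjoint.  Level [k] of the tree carries
   [2 ^ k] disjoint full rows and [2 ^ k] disjoint full columns, so for [k]
   large there are a row and a column whose bad orbits avoid the finite boundary
   of [A].  Walking along them from their common vertex [v] to the four sides of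
   the carpet and back gives, for every [g], an element with section [g] at [v]
   that preserves [A] on the bad orbits at [v].  Hence [v] has no bad orbit,
   and neither has the root.

   Amenability.  Consider the lazy random walk on [G] generated by [a], [b],
   [c], [d].  A section at a vertex of level [n] splits into blocks lying in
   finite dihedral groups such as [<a, b>]; a new block starts only when the walk
   on the level [n] carpet graph has crossed from one side to the opposite one.
   The expected number of crossings per step, summed over all vertices, is at
   most the Dirichlet energy of the coordinate function, which is
   [O((8 / 9) ^ n)].  So up to probability 1/2 the walk of length [m] lives on
   [exp(o(m))] elements, and Kesten's criterion applies. *)

Set Implicit Arguments.
Unset Strict Implicit.
Unset Printing Implicit Defensive.

Import Order.TTheory GRing.Theory Num.Theory.
Local Open Scope group_scope.

(** * The action on words, and reduction of words in the generators *)

Notation X := 'I_8.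
Notation G := carpet_group.

Definition act (g : G) : seq X -> seq X := val g.

Lemma actM g h w : act (g * h) w = act g (act h w).
Proof. by []. Qed.

Lemma act1 w : act 1 w = w.
Proof. by []. Qed.

Lemma act_ext g h : act g =1 act h -> g = h.
Proof. by move=> E; apply: val_inj; apply: tree_aut_ext. Qed.

Lemma actK g : cancel (act g) (act g^-1).
Proof. by move=> w; rewrite -actM mulVg. Qed.

Lemma actKV g : cancel (act g^-1) (act g).
Proof. by move=> w; rewrite -actM mulgV. Qed.

Definition letters : seq X :=
  [:: @Ordinal 8 0 isT; @Ordinal 8 1 isT; @Ordinal 8 2 isT; @Ordinal 8 3 isT;
      @Ordinal 8 4 isT; @Ordinal 8 5 isT; @Ordinal 8 6 isT; @Ordinal 8 7 isT].

Definition lt8 (k : nat) : X := nth (@Ordinal 8 0 isT) letters k.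

Lemma mem_letters (x : X) : x \in letters.
Proof. by case: x; do 8![case => //]. Qed.

Lemma letters_all (P : pred X) : all P letters -> forall x, P x.
Proof. by move=> /allP H x; apply/H/mem_letters. Qed.

Definition genlist : seq 'I_4 :=
  [:: @Ordinal 4 0 isT; @Ordinal 4 1 isT; @Ordinal 4 2 isT; @Ordinal 4 3 isT].

Lemma mem_genlist (s : 'I_4) : s \in genlist.
Proof. by case: s; do 4![case => //]. Qed.

Lemma gens_all (P : pred 'I_4) : all P genlist -> forall s, P s.
Proof. by move=> /allP H x; apply/H/mem_genlist. Qed.

(* The generators [a], [b], [c], [d] are numbered 0, 1, 2, 3, and the letters
   from 0. *)
Definition gperm (s : 'I_4) (x : X) : X :=
  lt8 (nth 0%N (nth [::] [:: [:: 1; 0; 2; 3; 4; 6; 5; 7];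
                           [:: 0; 1; 2; 5; 7; 3; 6; 4];
                           [:: 0; 2; 1; 3; 4; 5; 7; 6];
                           [:: 3; 1; 4; 0; 2; 5; 6; 7]]%N s) x).

Definition side (s : 'I_4) (x : X) : bool :=
  (x : nat) \in nth [::] [:: [:: 2; 4; 7]; [:: 0; 1; 2]; [:: 0; 3; 5];
                             [:: 5; 6; 7]]%N s.

Definition carpet_gen (s : 'I_4) : tree_aut X :=
  nth carpet_a [:: carpet_a; carpet_b; carpet_c; carpet_d] s.

Lemma carpet_gen_mem s :
  carpet_gen s \in generated [set carpet_a; carpet_b; carpet_c; carpet_d]%classic.
Proof.
rewrite inE; apply: sub_gen_smallest.
by case: s => [[|[|[|[|//]]]] i4]; do ?[by right | by left | left].
Qed.

Definition gen (s : 'I_4) : G := exist _ (carpet_gen s) (carpet_gen_mem s).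

Lemma letterE k : k < 8 -> letter k.+1 = lt8 k.
Proof.
move=> k8; apply: val_inj; rewrite /= inordK //.
by move: k8; do 8![case: k => [//|k]].
Qed.

Lemma gen_act s x u :
  act (gen s) (x :: u) = gperm s x :: (if side s x then act (gen s) u else u).
Proof.
have cst (i j k l : nat) (y : X) : i < 8 -> j < 8 -> k < 8 -> l < 8 ->
   (swap i.+1 j.+1 * swap k.+1 l.+1) y =
   let z := if y == lt8 i then lt8 j else if y == lt8 j then lt8 i else y in
   if z == lt8 k then lt8 l else if z == lt8 l then lt8 k else z.
  move=> i8 j8 k8 l8.
  by rewrite permM /swap !letterE // !permE.
have inS i j k (y : X) : i < 8 -> j < 8 -> k < 8 ->
   (y \in [set letter i.+1; letter j.+1; letter k.+1]%SET) =
   [|| y == lt8 i, y == lt8 j | y == lt8 k].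
  by move=> i8 j8 k8; rewrite !inE !letterE // orbA.
rewrite /act /gen /=.
case: s => [[|[|[|[|//]]]] i4]; rewrite /carpet_gen /= cst // inS //;
  congr (_ :: _); try by [apply/eqP; move: x; apply: letters_all];
  congr (if _ then _ else _); apply/eqP; move: x; apply: letters_all; by vm_compute.
Qed.

Lemma gen_act0 s : act (gen s) [::] = [::].
Proof. by rewrite /act /gen /=; case: s => [[|[|[|[|//]]]] i4]. Qed.

Lemma gpermK s : involutive (gperm s).
Proof.
move=> x; apply/eqP; move: x; apply: letters_all; move: s; apply: gens_all.
by vm_compute.
Qed.

Lemma side_gperm s x : side s x -> gperm s x = x.
Proof.
suff H : side s x ==> (gperm s x == x) by move=> xs; apply/eqP/(implyP H).
by move: x; apply: letters_all; move: s; apply: gens_all; vm_compute.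
Qed.

Lemma side_gpermE s x : side s (gperm s x) = side s x.
Proof.
apply/idP/idP => H; last by rewrite (side_gperm H).
by have := side_gperm H; rewrite gpermK => ->.
Qed.

Lemma genK s u : act (gen s) (act (gen s) u) = u.
Proof.
elim: u => [|x u IH]; first by rewrite !gen_act0.
by rewrite !gen_act gpermK side_gpermE; case: (side s x); rewrite ?IH.
Qed.

Lemma genV s : (gen s)^-1 = gen s.
Proof.
apply: act_ext => u; apply: (can_inj (actK (gen s))).
by rewrite actKV genK.
Qed.

(** The generators are involutions, so left multiplication by them reaches every element. The [g]
    such that left multiplication by [g] and [g^-1] preserves [P] form a subgroup containing
    them. *)
Lemma gen_ind (P : G -> Prop) :
  P 1 -> (forall s g, P g -> P (gen s * g)) -> forall g, P g.
Proof.
move=> P1 PM g.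
pose Q (g : G) := forall h, P h -> P (g * h) /\ P (g^-1 * h).
suff : Q g by move=> /(_ _ P1) []; rewrite mulg1.
pose H : set (tree_aut X) := [set t | exists2 h : G, val h = t & Q h]%classic.
suff sub : (generated [set carpet_a; carpet_b; carpet_c; carpet_d] `<=` H)%classic.
  have [|h E Qh] := sub (val g); first by case: g => g /=; rewrite inE.
  by rewrite -(val_inj E).
apply: smallest_sub.
  split; first by rewrite inE; exists 1 => // h; rewrite invg1 mul1g.
  move=> x y; rewrite !inE => -[g1 <- Q1] [g2 <- Q2].
  exists (g1 * g2^-1) => // h Ph; rewrite invMg invgK -!mulgA; split.
    by apply: (proj1 (Q1 _ _)); apply: (proj2 (Q2 _ _)).
  by apply: (proj1 (Q2 _ _)); apply: (proj2 (Q1 _ _)).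
have Qg s : Q (gen s) by move=> h Ph; rewrite genV; split; apply: PM.
move=> t [[[]|]|] ->.
- by exists (gen (@Ordinal 4 0 isT)).
- by exists (gen (@Ordinal 4 1 isT)).
- by exists (gen (@Ordinal 4 2 isT)).
- by exists (gen (@Ordinal 4 3 isT)).
Qed.

Definition ev (w : seq 'I_4) : G := foldr (fun s g => gen s * g) 1 w.

Lemma ev_cat w w' : ev (w ++ w') = ev w * ev w'.
Proof. by elim: w => [|s w /= ->]; rewrite ?mul1g ?mulgA. Qed.

Lemma ev_rev w : ev (rev w) = (ev w)^-1.
Proof.
elim: w => [|s w IH]; first by rewrite invg1.
by rewrite rev_cons -cats1 ev_cat IH /= mulg1 invMg genV.
Qed.

Definition push (s : 'I_4) (w : seq 'I_4) : seq 'I_4 :=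
  if w is t :: w' then if s == t then w' else s :: w else [:: s].

Lemma ev_push s w : ev (push s w) = gen s * ev w.
Proof.
case: w => [|t w] //=; case: eqP => [->|//].
by rewrite -{1}genV mulKg.
Qed.

(* [run w x] is the image of the letter [x] under [ev w], together with a
   freely reduced word for the section of [ev w] at [x]. *)
Definition run (w : seq 'I_4) (x : X) : X * seq 'I_4 :=
  foldr (fun s p => (gperm s p.1, if side s p.1 then push s p.2 else p.2))
        (x, [::]) w.

Lemma act_run w x u :
  act (ev w) (x :: u) = (run w x).1 :: act (ev (run w x).2) u.
Proof.
elim: w => [|s w IH] //=; rewrite actM IH gen_act.
by case: ifP; rewrite // ev_push actM.
Qed.

(** * Rigid elements and copies of the group below vertices *)

Definition rigid (f : X -> X) (r : G) : Prop :=
  forall x u, act r (x :: u) = f x :: u.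

Lemma run_rigid (f : X -> X) w :
  all (fun x => run w x == (f x, [::])) letters -> rigid f (ev w).
Proof.
by move=> /letters_all H x u; rewrite act_run (eqP (H x)).
Qed.

Lemma run_fst_rigid w :
  all (fun x => (run w x).2 == [::]) letters ->
  rigid (fun x => (run w x).1) (ev w).
Proof. by move=> /letters_all H x u; rewrite act_run (eqP (H x)). Qed.

Lemma rigidM f r f' r' : rigid f r -> rigid f' r' -> rigid (f \o f') (r * r').
Proof. by move=> H H' x u; rewrite actM H' H. Qed.

Lemma rigid_inj f r : rigid f r -> injective f.
Proof.
move=> H x y E; have := H y [::]; rewrite -E -(H x).
by move/(can_inj (actK r)) => [].
Qed.

Lemma rigidV f f' r : rigid f r -> cancel f f' -> rigid f' r^-1.
Proof.
move=> H fK x u; have [g _ gK] := injF_bij (rigid_inj H).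
by apply: (can_inj (actK r)); rewrite actKV H -[x]gK fK.
Qed.

Definition ga : 'I_4 := @Ordinal 4 0 isT.
Definition gb : 'I_4 := @Ordinal 4 1 isT.
Definition gc : 'I_4 := @Ordinal 4 2 isT.
Definition gd : 'I_4 := @Ordinal 4 3 isT.

Definition commw (u v : seq 'I_4) := u ++ v ++ rev u ++ rev v.

Lemma ev_comm u v : ev (commw u v) = [~ (ev u)^-1, (ev v)^-1].
Proof. by rewrite /commg /conjg !ev_cat !ev_rev !invgK !mulgA. Qed.

(* [(st)^2] and [(tr)^2] permute three letters each and have one nontrivial
   section; the supports of the two elements share a single letter, which both
   move.  Hence their commutator is a rigid 3-cycle. *)
Definition tri (x y z t : 'I_4) := commw [:: x; y; x; y] [:: z; t; z; t].

(** Words with trivial sections that carry the letter numbered 2 to [x], as [rigid_trans] verifies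
    by computation. *)
Definition from2 (x : X) : seq 'I_4 :=
  nth [::] [:: tri gd gc gd ga; tri gc gd gd ga ++ tri gd gc gd ga; [::];
               tri gd gc ga gd; tri gb gc gc gd;
               tri ga gd ga gb ++ tri gd gc gd ga;
               tri ga gb gc gb ++ tri gb gc gc gd;
               tri gc gb gc gd ++ tri gb gc gc gd] x.

(** A quarter turn of the carpet permutes the generators and the corners cyclically, so words for
    [a] yield words for all four. *)
Definition rot (s t : 'I_4) : 'I_4 := nth ga (genlist ++ genlist) (s + t).

Definition flat (s : 'I_4) : seq 'I_4 :=
  map (rot s) (tri gc gd gd ga ++ tri gb gc gd gc ++ tri gb ga gc gb).

Definition corner (s : 'I_4) : X := lt8 (nth 0%N [:: 2; 0; 5; 7]%N s).

(* [flat ga ++ [:: ga]] acts as [a] below the letters 2, 4, 7 and fixes every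
   other letter; multiplying it with two conjugates cancels [a] below all
   letters but 2. *)
Definition below_corner (s : 'I_4) : seq 'I_4 :=
  map (rot s) (let z := flat ga ++ [:: ga] in
               let u := tri ga gb gb gc in let v := tri ga gb gc gb in
               u ++ z ++ rev u ++ z ++ v ++ z ++ rev v).

Definition below (s : 'I_4) (x : X) : seq 'I_4 :=
  let t := from2 x ++ rev (from2 (corner s)) in
  t ++ below_corner s ++ rev t.

Lemma below_ok s x y :
  run (below s x) y == (y, if y == x then [:: s] else [::]).
Proof.
move: y; apply: letters_all; move: x; apply: letters_all.
by move: s; apply: gens_all; vm_compute.
Qed.

(** A generator permutes the letters by two transpositions, an even permutation and hence a product
    of 3-cycles. *)
Lemma flat_rigid s : rigid (gperm s) (ev (flat s)).
Proof. by apply: run_rigid; move: s; apply: gens_all; vm_compute. Qed.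

Lemma graft_ex x g : exists g', forall y u,
  act g' (y :: u) = y :: (if y == x then act g u else u).
Proof.
elim/gen_ind: g => [|s g [g' IH]].
  by exists 1 => y u; rewrite !act1 if_same.
exists (ev (below s x) * g') => y u.
rewrite actM IH act_run (eqP (below_ok s x y)) /=.
by case: ifP => _ //=; rewrite mulg1 actM.
Qed.

Definition graft (x : X) (g : G) : G := projT1 (cid (graft_ex x g)).

Lemma act_graft x g y u :
  act (graft x g) (y :: u) = y :: (if y == x then act g u else u).
Proof. by rewrite /graft; case: cid => /= g' ->. Qed.

Lemma act_nil g : act g [::] = [::].
Proof.
elim/gen_ind: g => [|s g IH]; first by rewrite act1.
by rewrite actM IH gen_act0.
Qed.

Lemma act_ext1 g h : (forall x u, act g (x :: u) = act h (x :: u)) -> g = h.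
Proof. by move=> E; apply: act_ext => -[|x u]; rewrite ?act_nil. Qed.

Lemma graftM x g h : graft x (g * h) = graft x g * graft x h.
Proof.
by apply: act_ext1 => y u; rewrite actM !act_graft; case: ifP; rewrite ?actM.
Qed.

Lemma graft1 x : graft x 1 = 1.
Proof. by apply: act_ext1 => y u; rewrite act_graft !act1 if_same. Qed.

Lemma graft_commute x y g h : x != y -> commute (graft x g) (graft y h).
Proof.
move=> xy; apply: act_ext1 => z u; rewrite !actM !act_graft.
by case: (eqVneq z x) => [->|_]; rewrite ?(negPf xy) //; case: ifP.
Qed.

Definition below_word (v : seq X) (g : G) : G := foldr graft g v.

Lemma below_wordM v g h :
  below_word v (g * h) = below_word v g * below_word v h.
Proof. by elim: v => //= x v ->; rewrite graftM. Qed.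

Lemma below_word1 v : below_word v 1 = 1.
Proof. by elim: v => //= x v ->; rewrite graft1. Qed.

Lemma below_wordV v g : below_word v g^-1 = (below_word v g)^-1.
Proof.
apply: (mulgI (below_word v g)).
by rewrite -below_wordM !mulgV below_word1.
Qed.

Lemma below_word_cat v w g :
  below_word (v ++ w) g = below_word v (below_word w g).
Proof. by rewrite /below_word foldr_cat. Qed.

Lemma act_below v g u : act (below_word v g) (v ++ u) = v ++ act g u.
Proof. by elim: v => //= x v IH; rewrite act_graft eqxx IH. Qed.

Lemma act_below_id v g w : ~~ prefix v w -> act (below_word v g) w = w.
Proof.
elim: v w => [|x v IH] [|y w] //= H; first by rewrite act_nil.
rewrite act_graft; case: (eqVneq y x) => [E|//]; move: H.
by rewrite E eqxx /= => /IH ->.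
Qed.

Definition incomp (v w : seq X) := ~~ prefix v w && ~~ prefix w v.

Lemma below_commute v w g h :
  incomp v w -> commute (below_word v g) (below_word w h).
Proof.
rewrite /incomp; elim: v w => [|x v IH] [|y w] //=.
have [->|xy _] := eqVneq x y; last exact: graft_commute.
rewrite /= => /IH E.
by rewrite /commute -!graftM E.
Qed.

Lemma incomp_sym v w : incomp v w = incomp w v.
Proof. by rewrite /incomp andbC. Qed.

Lemma incomp_size v w : size v = size w -> v != w -> incomp v w.
Proof.
move=> E vw; rewrite /incomp !prefixE {1}E take_size -E take_size.
by rewrite eq_sym andbb.
Qed.

Lemma incomp_catl v v' w : incomp v w -> incomp (v ++ v') w.
Proof.
rewrite /incomp => /andP[vw wv]; apply/andP; split.
  by apply: contra vw; apply: prefix_trans; apply: prefix_prefix.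
apply/negP => /prefixP [t E].
have [le|lt] := leqP (size w) (size v).
  case/negP: wv; rewrite prefixE.
  by by have := congr1 (take (size w)) E; rewrite (takel_cat _ le) take_size_cat // => ->.
case/negP: vw; rewrite prefixE.
have := congr1 (take (size v)) E.
by rewrite (takel_cat _ (ltnW lt)) take_size_cat // => <-.
Qed.

Lemma incomp_cat v w w' : incomp (v ++ w) (v ++ w') = incomp w w'.
Proof. by rewrite /incomp; elim: v => //= x v IH; rewrite !eqxx. Qed.

Lemma size_act g v : size (act g v) = size v.
Proof.
elim/gen_ind: g v => [|s g IH] v; first by rewrite act1.
rewrite actM -(IH v); elim: (act g v) => [|x u IHu]; first by rewrite gen_act0.
by rewrite gen_act; case: ifP => _ /=; rewrite ?IHu.
Qed.

(** A generator is its letter permutation, rigid by [flat_rigid], combined with itself below the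
    letters of its side. *)
Lemma wreath g : exists f r (k : X -> G), rigid f r /\
  forall x u, act g (x :: u) = f x :: act (k x) u.
Proof.
elim/gen_ind: g => [|s g [f [r [k [fr IH]]]]].
  by exists id, 1, (fun=> 1).
exists (gperm s \o f), (ev (flat s) * r),
  (fun x => if side s (f x) then gen s * k x else k x); split.
  exact: rigidM (flat_rigid s) fr.
by move=> x u; rewrite actM IH gen_act /=; case: ifP; rewrite ?actM.
Qed.

Lemma act_section g v : exists g', forall u, act g (v ++ u) = act g v ++ act g' u.
Proof.
elim: v g => [|x v IH] g; first by exists g => u; rewrite act_nil.
have [f [_ [k [_ E]]]] := wreath g; have [g' E'] := IH (k x).
by exists g' => u; rewrite /= !E E'.
Qed.

(** Off [v] both sides act as [f], because [f] maps words without prefix [v] to words without prefix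
    [v']. *)
Lemma below_conj f v v' k h : (forall u, act f (v ++ u) = v' ++ act k u) ->
  f * below_word v h = below_word v' (k * h * k^-1) * f.
Proof.
move=> E; apply: act_ext => w; rewrite !actM.
have [/prefixP [u ->]|vw] := boolP (prefix v w).
  by rewrite act_below !E act_below !actM actK.
rewrite (act_below_id _ vw) act_below_id //; apply: contra vw => /prefixP [u Eu].
have : act f (v ++ act k^-1 u) = act f w by rewrite E Eu actKV.
by move/(can_inj (actK f)) <-; apply: prefix_prefix.
Qed.

Lemma rigid_trans x y : exists f r, rigid f r /\ f x = y.
Proof.
have H z : exists f r, rigid f r /\ f (lt8 2) = z.
  exists (fun x => (run (from2 z) x).1), (ev (from2 z)); split.
    by apply: run_fst_rigid; move: z; apply: letters_all; vm_compute.
  by apply/eqP; move: z; apply: letters_all; vm_compute.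
have [f [r [fr fx]]] := H x; have [f' [r' [fr' fy]]] := H y.
have [g fK _] := injF_bij (rigid_inj fr).
exists (f' \o g), (r' * r^-1); split; last by rewrite /= -fx fK.
exact: rigidM fr' (rigidV fr fK).
Qed.

Lemma level_trans v v' : size v = size v' ->
  exists f, forall u, act f (v ++ u) = v' ++ u.
Proof.
elim: v v' => [|x v IH] [|y v'] //=; first by exists 1.
move=> [/IH [f E]]; have [s [r [sr <-]]] := rigid_trans x y.
by exists (r * graft x f) => u; rewrite actM act_graft eqxx sr E.
Qed.

Lemma comm_cycle : exists p q f, [/\ rigid f [~ p, q],
  f (lt8 3) = lt8 7, f (lt8 7) = lt8 6 & f (lt8 6) = lt8 3].
Proof.
exists (ev [:: ga; gb; ga; gb])^-1, (ev [:: gb; gc; gb; gc])^-1.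
exists (fun x => (run (tri ga gb gb gc) x).1); rewrite -ev_comm; split.
- by apply: run_fst_rigid; vm_compute.
- by apply/eqP; vm_compute.
- by apply/eqP; vm_compute.
- by apply/eqP; vm_compute.
Qed.

Lemma comm_moves x : exists p q f, rigid f [~ p, q] /\ f x != x.
Proof.
have [p [q [f [fr f3 _ _]]]] := comm_cycle.
have [g [r [gr gx]]] := rigid_trans x (lt8 3).
have [g' gK g'K] := injF_bij (rigid_inj gr).
exists (p ^ r), (q ^ r), (g' \o f \o g); split.
  rewrite -conjRg /conjg mulgA.
  exact: (rigidM (rigidM (rigidV gr gK) fr) gr).
by apply/eqP => /(congr1 g) /=; rewrite g'K gx f3.
Qed.

Local Open Scope classical_set_scope.

Definition grafts (l : seq X) (k : X -> G) : G :=
  foldr (fun x g => graft x (k x) * g) 1 l.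

Lemma act_grafts l k x u : uniq l ->
  act (grafts l k) (x :: u) = x :: (if x \in l then act (k x) u else u).
Proof.
elim: l => [|y l IH] //= /andP[yl /IH E].
rewrite actM E act_graft inE; case: (eqVneq x y) => //= -> {E}.
by rewrite (negPf yl).
Qed.

Lemma grafts_commute l k x h : uniq l -> x \notin l ->
  commute (grafts l k) (graft x h).
Proof.
move=> ul xl; apply: act_ext1 => y u.
rewrite !actM act_grafts // !act_graft act_grafts //.
by case: eqVneq => [->|_] //; rewrite (negPf xl).
Qed.

Lemma uniq_letters : uniq letters. Proof. by []. Qed.

Lemma mem_rem_letters x y : (x \in rem y letters) = (x != y).
Proof. by rewrite mem_rem_uniq // -[RHS]andbT -(mem_letters x). Qed.

Lemma wreath_prod g : exists f r (k : X -> G),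
  [/\ rigid f r, forall x u, act g (x :: u) = f x :: act (k x) u &
   forall x0, g = r * (grafts (rem x0 letters) k * graft x0 (k x0))].
Proof.
have [f [r [k [fr E]]]] := wreath g; exists f, r, k; split=> // x0.
apply: act_ext1 => x u; rewrite E !actM act_graft act_grafts ?rem_uniq //.
by rewrite fr mem_rem_letters; case: eqVneq => [->|].
Qed.

Lemma below_rcons u x g : below_word (rcons u x) g = below_word u (graft x g).
Proof. by rewrite -cats1 below_word_cat. Qed.

(** A rigid element is determined by its letter map; this turns unions over rigid elements into
    unions over the finite type [{ffun X -> X}]. *)
Definition rigid_elt (f : X -> X) : G :=
  if pselect (exists r, rigid f r) is left ex then projT1 (cid ex) else 1.

Lemma rigid_eltE f r : rigid f r -> rigid_elt (finfun f) = r.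
Proof.
move=> fr; have fr' : rigid (finfun f) r by move=> x u; rewrite fr ffunE.
rewrite /rigid_elt; case: pselect => [ex|[]]; last by exists r.
by case: cid => r' /= fr''; apply: act_ext1 => x u; rewrite fr' fr''.
Qed.

(** * Bad orbits of a commensurated set *)

Section Commensurated.
Variables (Y : eqType) (rho : G -> Y -> Y).
Hypothesis rhoP : is_left_action rho.

Lemma rho1 y : rho 1 y = y. Proof. by case: rhoP. Qed.

Lemma rhoM g h y : rho (g * h) y = rho g (rho h y). Proof. by case: rhoP. Qed.

Lemma rhoK g : cancel (rho g) (rho g^-1).
Proof. by move=> y; rewrite -rhoM mulVg rho1. Qed.

Lemma rhoKV g : cancel (rho g^-1) (rho g).
Proof. by move=> y; rewrite -rhoM mulgV rho1. Qed.

Definition orb (v : seq X) (y : Y) : set Y :=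
  [set z | exists g, z = rho (below_word v g) y].

Lemma orb_refl v y : orb v y y.
Proof. by exists 1; rewrite below_word1 rho1. Qed.

Lemma orb_eq v y z : orb v y z -> orb v z = orb v y.
Proof.
move=> [g ->]; apply/seteqP; split=> t [h ->].
  by exists (h * g); rewrite below_wordM rhoM.
by exists (h * g^-1); rewrite below_wordM rhoM below_wordV rhoK.
Qed.

Lemma orb_sym v y z : orb v y z -> orb v z y.
Proof. by move=> /orb_eq ->; apply: orb_refl. Qed.

Lemma orb_map f v v' y (k : G) :
  (forall h, f * below_word v h = below_word v' (k * h * k^-1) * f) ->
  orb v' (rho f y) = rho f @` orb v y.
Proof.
move=> E; apply/seteqP; split=> [t [h ->]|t [z [h ->] <-]].
  exists (rho (below_word v (k^-1 * h * k)) y); first by eexists.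
  by rewrite -!rhoM E !mulgA mulgV mul1g mulgK.
by rewrite -!rhoM E rhoM; eexists.
Qed.

Lemma commute_map c v : (forall h, commute c (below_word v h)) ->
  forall h, c * below_word v h = below_word v (1 * h * 1^-1) * c.
Proof. by move=> H h; rewrite mul1g invg1 mulg1 H. Qed.

Section Fixed.
Variable A : set Y.
Hypothesis AP : commensurated rho A.

Definition moved g : set Y := [set z | ~ (A z <-> A (rho g z))].

Lemma finite_moved g : finite_set (moved g).
Proof.
apply: (@sub_finite_set _ _ (rho g^-1 @` ((rho g @` A) `+` A))).
  move=> z mz; exists (rho g z); last by rewrite rhoK.
  have [Az|nAz] := pselect (A z); [left|right]; split.
  - by exists z.
  - by move=> Agz; apply: mz.
  - by apply: contrapT => nA; apply: mz; split.
  - by move=> [t At /(can_inj (rhoK g)) tz]; apply: nAz; rewrite -tz.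
exact/finite_image/AP.
Qed.

Definition boundary v : set Y :=
  \bigcup_(s in [set: 'I_4]) moved (below_word v (gen s)).

Lemma finite_boundary v : finite_set (boundary v).
Proof.
apply: bigcup_finite => [|s _]; first exact: finite_finset.
exact: finite_moved.
Qed.

Lemma unbroken v y : (forall z, orb v y z -> ~ boundary v z) ->
  forall z, orb v y z -> (A z <-> A y).
Proof.
move=> H z [g ->]; elim/gen_ind: g => [|s g IH].
  by rewrite below_word1 rho1.
rewrite -IH below_wordM rhoM.
have := H (rho (below_word v g) y) (ex_intro _ g erefl).
move=> nb; symmetry; apply: contrapT => m; apply: nb.
by exists s.
Qed.

Definition bad v y :=
  infinite_set (orb v y `&` A) /\ infinite_set (orb v y `\` A).

Lemma bad_orb v y z : orb v y z -> bad v y -> bad v z.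
Proof. by rewrite /bad => /orb_eq ->. Qed.

Lemma bad_inf v y : bad v y -> infinite_set (orb v y).
Proof. by move=> [inf _] fin; apply: inf; apply: finite_setIl. Qed.

(** By [unbroken], [A] is constant on an orbit that avoids the boundary. As the boundary is finite,
    only finitely many orbits at [v] are bad. *)
Lemma bad_boundary v y : bad v y -> exists2 z, boundary v z & orb v y z.
Proof.
move=> [Ai Aic]; apply: contrapT => nb.
have ub : forall z, orb v y z -> (A z <-> A y).
  by apply: unbroken => z yz bz; apply: nb; exists z.
have [Ay|nAy] := pselect (A y).
  apply: Aic; rewrite (_ : _ `\` _ = set0); first exact: finite_set0.
  by rewrite -subset0 => z [/ub E]; case; apply/E.
apply: Ai; rewrite (_ : _ `&` _ = set0); first exact: finite_set0.
by rewrite -subset0 => z [/ub E /E].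
Qed.

Lemma bad_map f v v' y (k : G) :
  (forall h, f * below_word v h = below_word v' (k * h * k^-1) * f) ->
  bad v y -> bad v' (rho f y).
Proof.
move=> E [Ai Aic]; rewrite /bad (orb_map _ E).
have back (S : set Y) : finite_set S -> finite_set (rho f @^-1` S).
  move=> fS; apply: (sub_finite_set (B := rho f^-1 @` S)).
    by move=> z Sz; exists (rho f z) => //; rewrite rhoK.
  exact: finite_image.
split=> fin; [apply: Ai|apply: Aic].
  apply: (sub_finite_set (B := moved f `|` (rho f @^-1` (rho f @` orb v y `&` A)))).
    move=> z [oz Az]; have [m|nm] := pselect (moved f z); [by left|right].
    split; first by exists z.
    by apply: contrapT => nA; apply: nm => -[/(_ Az)].
  by rewrite finite_setU; split; [apply: finite_moved|apply: back].
apply: (sub_finite_set (B := moved f `|` (rho f @^-1` (rho f @` orb v y `\` A)))).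
  move=> z [oz nAz]; have [m|nm] := pselect (moved f z); [by left|right].
  split; first by exists z.
  by move=> /= Af; apply: nm => -[_ /(_ Af)].
by rewrite finite_setU; split; [apply: finite_moved|apply: back].
Qed.

Lemma bad_commute c v y : (forall h, commute c (below_word v h)) ->
  bad v y -> bad v (rho c y).
Proof. by move=> /commute_map/bad_map; apply. Qed.

Lemma bad_section f v v' y k : (forall u, act f (v ++ u) = v' ++ act k u) ->
  bad v y -> bad v' (rho f y).
Proof.
by move=> E; apply: (bad_map (k := k)) => h; apply: below_conj.
Qed.

Lemma bad_level v v' y : size v = size v' -> bad v y -> exists z, bad v' z.
Proof.
move=> /level_trans [f E] b; exists (rho f y).
by apply: (bad_section (k := 1)) b => u; rewrite E act1.
Qed.

Definition wide_orb v y : set Y :=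
  [set z | exists c g, (forall h, commute c (below_word v h)) /\
                       z = rho (c * below_word v g) y].

(* The centralizer of the copy of [G] at [v] permutes its orbits up to finite
   changes of [A]; only finitely many of these orbits meet the boundary, and the
   others are contained in [A]. *)
Lemma wide_orb_finite v y : infinite_set (orb v y) ->
  finite_set (orb v y `\` A) -> finite_set (wide_orb v y `\` A).
Proof.
move=> oi fin.
have step z : wide_orb v y z ->
    infinite_set (orb v z) /\ finite_set (orb v z `\` A).
  move=> [c [g [cc ->]]]; rewrite rhoM.
  have oE : orb v (rho (below_word v g) y) = orb v y by apply: orb_eq; exists g.
  rewrite (orb_map _ (commute_map cc)) oE; split.
    move=> fi; apply: oi.
    apply: (sub_finite_set (B := rho c^-1 @` (rho c @` orb v y))).
      by move=> t ot; exists (rho c t); [exists t | rewrite rhoK].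
    exact: finite_image.
  apply: (sub_finite_set (B := rho c @` (moved c `|` (orb v y `\` A)))).
    move=> _ [[t ot <-] nA]; exists t => //.
    have [m|nm] := pselect (moved c t); [by left|right]; split => // At.
    by apply: nm => -[/(_ At)].
  by apply: finite_image; rewrite finite_setU; split => //; apply: finite_moved.
apply: (sub_finite_set (B := \bigcup_(d in boundary v `&` wide_orb v y)
                               (orb v d `\` A))); last first.
  apply: bigcup_finite => [|d [_ /step []]//].
  exact/finite_setIl/finite_boundary.
move=> z [wz nAz]; have [zi zf] := step z wz.
have [d bd zd] : exists2 d, boundary v d & orb v z d.
  apply: contrapT => nb; apply: zi.
  apply: sub_finite_set zf => t zt; split=> // At; apply: nAz.
  apply/(unbroken _ zt) => // u zu bu; apply: nb; by exists u.
exists d; last by split=> //; apply: orb_sym.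
split=> //; move: wz zd => [c [g [cc ->]]] [h ->].
exists c, (h * g); split=> //.
by rewrite -rhoM below_wordM !mulgA cc.
Qed.

(** By [wreath_prod], an element of the copy at [u] is one of finitely many rigid factors times a
    product of an element centralizing the copy at [rcons u x] and an element of that copy. So
    finitely many translates of the wide orbit cover the orbit at [u]. *)
Lemma orb_sub_wide u x y :
  finite_set (wide_orb (rcons u x) y `\` A) -> finite_set (orb u y `\` A).
Proof.
move=> fin; apply: (sub_finite_set (B := \bigcup_(f in [set: {ffun X -> X}])
  (rho (below_word u (rigid_elt f)) @`
    (moved (below_word u (rigid_elt f)) `|` (wide_orb (rcons u x) y `\` A))))).
  move=> _ [[g ->] nA]; have [f [r [k [fr _ /(_ x) E]]]] := wreath_prod g.
  exists (finfun f) => //; rewrite (rigid_eltE fr).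
  exists (rho (below_word u (grafts (rem x letters) k * graft x (k x))) y).
    set t := rho _ y; have [m|nm] := pselect (moved (below_word u r) t).
      by left.
    right; split=> [|At].
      exists (below_word u (grafts (rem x letters) k)), (k x); split.
        move=> h; rewrite below_rcons /commute -!below_wordM.
        by rewrite grafts_commute ?rem_uniq // mem_rem_letters eqxx.
      by rewrite below_rcons -below_wordM.
    apply: nm => -[/(_ At)]; rewrite -rhoM -below_wordM -E => Ag _.
    exact: nA Ag.
  by rewrite -rhoM -below_wordM -E.
apply: bigcup_finite => [|f _]; first exact: finite_finset.
by apply: finite_image; rewrite finite_setU; split => //; apply: finite_moved.
Qed.

End Fixed.

Lemma commensuratedC A : commensurated rho A -> commensurated rho (~` A).
Proof.
move=> AP g; apply: sub_finite_set (AP g) => z [[[t nAt <-] nA]|[nA nT]].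
  right; split; first by apply: contrapT.
  by move=> [t' At' /(can_inj (rhoK g)) E]; apply: nAt; rewrite -E.
left; split; last by [].
exists (rho g^-1 z); last by rewrite rhoKV.
by apply: contrapT => nA'; apply: nT; exists (rho g^-1 z) => //; rewrite rhoKV.
Qed.

Section Fixed2.
Variable A : set Y.
Hypothesis AP : commensurated rho A.
Notation bad := (bad A).

Lemma wide_orbP v y : infinite_set (orb v y) -> ~ bad v y ->
  finite_set (wide_orb v y `&` A) \/ finite_set (wide_orb v y `\` A).
Proof.
move=> oi nb; have [fin|inf] := pselect (finite_set (orb v y `\` A)).
  by right; apply: wide_orb_finite.
left; rewrite -[A in _ `&` A]setCK -setDE.
apply: wide_orb_finite => //; first exact: commensuratedC.
by rewrite setDE setCK; apply: contrapT => inf'; apply: nb.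
Qed.

(** The copies at [u] and [v] commute, so the orbit at [v] lies in the wide orbit at [u]. If the
    orbit at [u] were infinite and not bad, [A] would be finite or cofinite there. *)
Lemma dichotomy u v y : incomp u v -> bad v y ->
  bad u y \/ finite_set (orb u y).
Proof.
move=> uv [Ai Aic]; have [b|nb] := pselect (bad u y); [by left|right].
apply: contrapT => oi; have sub : orb v y `<=` wide_orb u y.
  move=> _ [g ->]; exists (below_word v g), 1; split=> [h|].
    by apply: below_commute; rewrite incomp_sym.
  by rewrite below_word1 mulg1.
have [fin|fin] := wide_orbP oi nb; [apply: Ai|apply: Aic];
  apply: sub_finite_set fin.
  exact: setSI.
exact: setSD.
Qed.

Lemma orb_commute_finite c v y : (forall h, commute c (below_word v h)) ->
  finite_set (orb v y) -> finite_set (orb v (rho c y)).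
Proof.
by move=> /commute_map cc fin; rewrite (orb_map _ cc); apply: finite_image.
Qed.

Lemma grafts_finite p l y : uniq l ->
  (forall x, x \in l -> finite_set (orb (rcons p x) y)) ->
  finite_set [set z | exists k, z = rho (below_word p (grafts l k)) y].
Proof.
elim: l => [|x l IH] /=.
  move=> _ _; apply: sub_finite_set (finite_set1 y) => _ [k ->].
  by rewrite below_word1 rho1.
move=> /andP[xl ul] fin.
apply: (sub_finite_set (B := \bigcup_(z in
   [set z | exists k, z = rho (below_word p (grafts l k)) y]) orb (rcons p x) z)).
  move=> _ [k ->]; exists (rho (below_word p (grafts l k)) y).
    by exists k.
  by exists (k x); rewrite below_wordM rhoM below_rcons.
apply: bigcup_finite => [|_ [k ->]].
  by apply: IH => // z zl; apply: fin; rewrite inE zl orbT.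
apply: orb_commute_finite; last by apply: fin; rewrite inE eqxx.
move=> h; rewrite below_rcons /commute -!below_wordM.
by rewrite (grafts_commute _ _ ul xl).
Qed.

Lemma rigid_finite p (S : set Y) : finite_set S ->
  finite_set [set z | exists f r t, [/\ rigid f r, S t &
                                        z = rho (below_word p r) t]].
Proof.
move=> fin; apply: (sub_finite_set (B := \bigcup_(f in [set: {ffun X -> X}])
    (rho (below_word p (rigid_elt f)) @` S))); last first.
  apply: bigcup_finite => [|f _]; [exact: finite_finset|exact: finite_image].
move=> _ [f [r [t [fr St ->]]]]; exists (finfun f) => //.
by exists t => //; rewrite (rigid_eltE fr).
Qed.

(** If the orbits at all children are finite, so is the orbit at [u]. If some child has an infinite
    orbit that is not bad, [orb_sub_wide] makes [A] finite or cofinite on the orbit at [u]. *)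
Lemma chain u y : bad u y -> exists x, bad (rcons u x) y.
Proof.
move=> b; apply: contrapT => nb.
have [fin|] := pselect (forall x, finite_set (orb (rcons u x) y)).
  apply: (bad_inf b).
  have F1 := grafts_finite (uniq_letters) (fun x _ => fin x).
  apply: sub_finite_set (rigid_finite u F1) => _ [g ->].
  have [f [r [k [fr _ E]]]] := wreath_prod g.
  exists f, r, (rho (below_word u (grafts letters k)) y); split=> //.
    by exists k.
  rewrite -rhoM -below_wordM; congr (rho (below_word u _) y).
  rewrite (E (lt8 0)); congr (_ * _).
  apply: act_ext1 => z w; rewrite actM act_graft.
  rewrite (act_grafts _ _ _ uniq_letters) mem_letters.
  rewrite act_grafts ?rem_uniq // mem_rem_letters.
  by case: eqVneq => [->|].
move=> /existsNP [x oi].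
have [Ai Aic] := b.
have [fin|fin] := wide_orbP oi (fun H => nb (ex_intro _ x H)).
  apply: Ai; rewrite -[A]setCK -setDE.
  by apply: orb_sub_wide (commensuratedC AP) _ _ _ _; rewrite setDE setCK; apply: fin.
by apply: Aic; apply: orb_sub_wide fin.
Qed.
End Fixed2.
End Commensurated.

(** * Commutators in normal subgroups of finite index *)

Lemma commg_mul_central (a b c d : G) : commute a d -> commute b a ->
  commute b c -> commute b d -> commute c d -> [~ a * b, c * d] = [~ a, c].
Proof.
move=> ad ba bc bd cd.
have commE (x y : G) : [~ x, y] = (y * x)^-1 * (x * y).
  by rewrite /commg /conjg invMg !mulgA.
have E1 : a * b * (c * d) = b * d * (a * c).
  by rewrite -ba -!mulgA cd (mulgA a d) ad !mulgA.
have E2 : c * d * (a * b) = b * d * (c * a).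
  by rewrite -ba -!mulgA (mulgA d b) -bd (mulgA c (b * d)) (mulgA c b) -bc
             -!mulgA (mulgA c d) cd !mulgA.
by rewrite !commE E1 E2 [(b * d * _)^-1]invMg -mulgA mulKg.
Qed.

Lemma below_wordR v g h :
  below_word v [~ g, h] = [~ below_word v g, below_word v h].
Proof. by rewrite /commg /conjg !below_wordM !below_wordV. Qed.

Definition finite_index (K : set G) : Prop :=
  exists (T : finType) (c : G -> T), forall g h, c g = c h -> K (g^-1 * h).

Record normal_subgroup (K : set G) : Prop := NormalSubgroup {
  nsubM : forall g h, K g -> K h -> K (g * h);
  nsubV : forall g, K g -> K g^-1;
  nsubJ : forall f g, K g -> K (f * g * f^-1) }.

Lemma finite_indexI K L :
  finite_index K -> finite_index L -> finite_index (K `&` L).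
Proof.
move=> [T [c cP]] [U [d dP]]; exists (T * U)%type, (fun g => (c g, d g)).
by move=> g h [/cP ? /dP].
Qed.

Lemma normal_subgroupI K L :
  normal_subgroup K -> normal_subgroup L -> normal_subgroup (K `&` L).
Proof.
move=> [KM KV KJ] [LM LV LJ]; split.
- by move=> g h [? ?] [? ?]; split; [apply: KM|apply: LM].
- by move=> g [? ?]; split; [apply: KV|apply: LV].
- by move=> f g [? ?]; split; [apply: KJ|apply: LJ].
Qed.

Section FiniteIndex.
Variable K : set G.
Hypotheses (Kn : normal_subgroup K) (Kf : finite_index K).

(* Pigeonhole over infinitely many pairwise incomparable vertices: [K] contains
   [p_w p_w'^-1] for two of them, hence also its commutator with [q_w], which
   is [[~ p, q]_w]. *)
Lemma nsub_comm p q : exists w, K (below_word w [~ p, q]).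
Proof.
have [T [c cP]] := Kf.
pose w i := rcons (nseq i (lt8 0)) (lt8 1).
have wI (i j : nat) : i != j -> incomp (w i) (w j).
  have sub (m n : nat) : m < n -> incomp (w m) (w n).
    move=> mn; rewrite /w -!cats1 -(subnKC mn) addSnnS nseqD -catA incomp_cat.
    by [].
  case: ltngtP => // [/sub//|/sub]; by rewrite incomp_sym.
pose F (i : 'I_#|T|.+1) := c (below_word (w i) p^-1).
have [i [j [ij Eij]]] : exists i j, i != j /\ F i = F j.
  apply: contrapT => nex; suff /card_in_imset E : {in [set: 'I_#|T|.+1]%SET &, injective F}.
    have := max_card (mem (F @: [set: 'I_#|T|.+1]%SET)).
    by rewrite E cardsT card_ord ltnn.
  move=> i j _ _ E; apply/eqP; apply: contrapT => /negP ij; apply: nex.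
  by exists i, j.
exists (w i); have := cP _ _ Eij; rewrite !below_wordV invgK => Kpp.
set pi := below_word (w i) p in Kpp; set pj := below_word (w j) p in Kpp.
set qi := below_word (w i) q.
have cpj g : commute (below_word (w i) g) pj^-1.
  by rewrite /pj -below_wordV; apply: below_commute; rewrite wI.
have -> : below_word (w i) [~ p, q] = [~ pi * pj^-1, qi * 1].
  rewrite commg_mul_central ?below_wordR //; try exact: commute1.
    exact/commute_sym/cpj.
  exact/commute_sym/cpj.
rewrite mulg1 /commg /conjg.
apply: (nsubM Kn); first exact: (nsubV Kn).
by have := nsubJ Kn qi^-1 Kpp; rewrite invgK -[X in K X]mulgA.
Qed.

(** [nsub_comm] puts a rigid 3-cycle below some [w] into [K]. Its commutators with copies are
    elements of [K] acting by [g] below one letter and by [g^-1] below another. Two of these that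
    share only the letter numbered 3 have commutator [[~ g, h]] there, and conjugation carries it to
    the whole level. *)
Lemma nsub_comm_level : exists m, forall w, size w = m -> forall g h,
  exists k1 k2, [/\ K k1, K k2 & below_word w [~ g, h] = [~ k1, k2]].
Proof.
have [p [q [f [fr f3 f7 f6]]]] := comm_cycle.
have [w Kw] := nsub_comm p q.
set r := below_word w _ in Kw.
pose v x := rcons w x.
have rJ x g : r * below_word (v x) g * r^-1 = below_word (v (f x)) g.
  have /below_conj -> : forall u, act r (v x ++ u) = v (f x) ++ act 1 u.
    by move=> u; rewrite /v !cat_rcons act_below fr act1.
  by rewrite mulgK mul1g invg1 mulg1.
have Kdiff x g : K (below_word (v x) g * (below_word (v (f x)) g)^-1).
  have := nsubV Kn (nsubM Kn Kw (nsubJ Kn (below_word (v x) g) (nsubV Kn Kw))).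
  by rewrite -(rJ x g) !invMg !invgK !mulgA.
exists (size w).+1 => w' sw' g h.
have vI (x y : X) g' h' : x != y ->
    commute (below_word (v x) g') (below_word (v y) h').
  by move=> xy; apply: below_commute; apply: incomp_size; rewrite ?size_rcons //
    eqseq_rcons eqxx.
have E : below_word (v (lt8 3)) [~ g, h] =
    [~ below_word (v (lt8 3)) g * (below_word (v (lt8 7)) g)^-1,
       below_word (v (lt8 3)) h * (below_word (v (lt8 6)) h)^-1].
  by rewrite below_wordR -!below_wordV commg_mul_central //; exact: vI.
have [t tE] : exists t, forall u, act t (v (lt8 3) ++ u) = w' ++ act 1 u.
  by apply: level_trans; rewrite size_rcons.
have tJ c : below_word w' c = t * below_word (v (lt8 3)) c * t^-1.
  by rewrite (below_conj _ tE) mulgK mul1g invg1 mulg1.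
exists (t * (below_word (v (lt8 3)) g * (below_word (v (lt8 7)) g)^-1) * t^-1).
exists (t * (below_word (v (lt8 3)) h * (below_word (v (lt8 6)) h)^-1) * t^-1).
split.
- by apply: (nsubJ Kn); rewrite -f3; apply: Kdiff.
(* Here [f] sends 6 to 3, so [Kdiff] yields the inverse of the wanted element. *)
- apply: (nsubJ Kn); rewrite -[X in X * _]invgK -invMg.
  by apply: (nsubV Kn); rewrite -f6; apply: Kdiff.
- have cj c : t * c * t^-1 = c ^ t^-1 by rewrite conjgE invgK mulgA.
  by rewrite tJ E !cj conjRg.
Qed.
End FiniteIndex.

(** * Disjointness of bad orbits at incomparable vertices *)

Section Disjoint.
Variables (Y : eqType) (rho : G -> Y -> Y).
Hypothesis rhoP : is_left_action rho.
Variable A : set Y.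
Hypothesis AP : commensurated rho A.

Notation orb := (orb rho).
Notation bad := (bad rho A).
Notation moved := (moved rho A).

Let rho1 := rho1 rhoP.
Let rhoM := rhoM rhoP.
Let rhoK := rhoK rhoP.
Let rhoKV := rhoKV rhoP.

Definition orb_kernel u v : set G :=
  [set g | forall z, bad v z -> orb v z (rho (below_word u g) z)].

Lemma orb_commute c v y z : (forall h, commute c (below_word v h)) ->
  orb v y z -> orb v (rho c y) (rho c z).
Proof.
by move=> /commute_map cc oz; rewrite (orb_map rhoP _ cc); exists z.
Qed.

Lemma orb_kernel_normal u v : incomp u v -> normal_subgroup (orb_kernel u v).
Proof.
move=> uv; have cuv g h : commute (below_word u g) (below_word v h).
  exact: below_commute.
split.
- move=> g h Kg Kh z bz; rewrite below_wordM rhoM.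
  have bhz := bad_commute rhoP AP (cuv h) bz.
  by rewrite -(orb_eq rhoP (Kh z bz)); apply: Kg.
- move=> g Kg z bz; rewrite below_wordV.
  have bz' : bad v (rho (below_word u g)^-1 z).
    by rewrite -below_wordV; apply: bad_commute.
  by apply: (orb_sym rhoP); have := Kg _ bz'; rewrite rhoKV.
- move=> f g Kg z bz; rewrite !below_wordM !rhoM below_wordV.
  have bz' : bad v (rho (below_word u f)^-1 z).
    by rewrite -below_wordV; apply: bad_commute.
  have := orb_commute (cuv f) (Kg _ bz'); by rewrite rhoKV.
Qed.

(** Boundary points represent all bad orbits at [v]. The colour of [g] records which representatives
    share an orbit after [below_word u g] acts, and so determines the permutation of the bad
    orbits. *)
Lemma orb_kernel_finite_index u v : incomp u v -> finite_index (orb_kernel u v).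
Proof.
move=> uv; have cuv g h : commute (below_word u g) (below_word v h).
  exact: below_commute.
have /finite_seqP [D DE] := finite_boundary rhoP AP v.
pose n := size D.
have rep z : bad v z -> exists y0 (i : 'I_n), orb v z (nth y0 D i).
  move=> /(bad_boundary rhoP) [y]; rewrite DE /= => yD yz.
  have iD : index y D < n by rewrite index_mem.
  by exists y, (Ordinal iD); rewrite /= nth_index.
have [[z0 bz0]|nb] := pselect (exists z, bad v z); last first.
  exists 'I_1, (fun=> ord0) => g h _ z bz; case: nb; by exists z.
pose d (i : 'I_n) := nth z0 D i.
have rep' z : bad v z -> exists i, orb v z (d i).
  by move=> /rep [y0 [i oi]]; exists i; rewrite /d (set_nth_default y0).
exists {ffun 'I_n * 'I_n -> bool}.
exists (fun g => [ffun p => `[< orb v (rho (below_word u g) (d p.1)) (d p.2) >]]).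
move=> g h E z bz; have [i oi] := rep' z bz.
have bd : bad v (d i) by apply: bad_orb bz.
have [j oj] := rep' _ (bad_commute rhoP AP (cuv g) bd).
have oj' : orb v (rho (below_word u h) (d i)) (d j).
  move/(congr1 (fun f : {ffun _} => f (i, j))): E; rewrite !ffunE /=.
  by rewrite (asboolT oj) => /esym/asboolW.
have oh : orb v (rho (below_word u g) (d i)) (rho (below_word u h) (d i)).
  by rewrite -(orb_eq rhoP oj); apply: (orb_sym rhoP).
have := orb_commute (cuv g^-1) oh.
rewrite -!rhoM -!below_wordM mulVg below_word1 rho1 => oz.
have zi := orb_commute (cuv (g^-1 * h)) (orb_sym rhoP oi).
rewrite -(orb_eq rhoP oi) -(orb_eq rhoP oz).
exact: zi.
Qed.

Lemma chain_level u y m : bad u y -> exists2 w, size w = m & bad (u ++ w) y.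
Proof.
move=> b; elim: m => [|m [w sw /(chain rhoP AP) [x bx]]].
  by exists [::]; rewrite ?cats0.
by exists (rcons w x); rewrite ?size_rcons ?sw // -rcons_cat.
Qed.

(** Descend from [u] to a vertex where a rigid commutator moving [x] preserves the orbit of [y] at
    [v]: its inverse moves [y] as some element of the copy at [v] does. That copy preserves badness
    at [rcons (u ++ w) x], and the rigid element carries badness to [rcons (u ++ w) (f x)]. *)
Lemma bad_split u v y : incomp u v -> bad u y -> bad v y -> exists p p',
  [/\ incomp p p', incomp p v, incomp p' v, bad p y & bad p' y].
Proof.
move=> uv bu bv.
have Kn := orb_kernel_normal uv.
have [m mP] := nsub_comm_level Kn (orb_kernel_finite_index uv).
have [w sw /(chain rhoP AP) [x bx]] := chain_level m bu.
have [p [q [f [fr fx]]]] := comm_moves x.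
have [k1 [k2 [K1 K2 E]]] := mP w sw p q.
have KR : orb_kernel u v (below_word w [~ p, q])^-1.
  apply: (nsubV Kn); rewrite E /commg /conjg.
  apply: (nsubM Kn); first exact: (nsubV Kn).
  by have := nsubJ Kn k2^-1 K1; rewrite invgK mulgA.
exists (rcons (u ++ w) x), (rcons (u ++ w) (f x)).
have inc z : incomp (rcons (u ++ w) z) v by rewrite rcons_cat; apply: incomp_catl.
split=> //.
  apply: incomp_size; rewrite ?size_rcons //.
  by rewrite eqseq_rcons eqxx eq_sym.
have [g Eg] := KR y bv.
have by' : bad (rcons (u ++ w) x) (rho (below_word v g) y).
  by apply: (bad_commute rhoP AP) bx => h; apply: below_commute; rewrite incomp_sym.
rewrite -Eg below_wordV -below_word_cat in by'.
have := bad_section rhoP AP (k := 1) _ by'.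
move=> /(_ (below_word (u ++ w) [~ p, q]) (rcons (u ++ w) (f x))).
rewrite rhoKV; apply=> t.
by rewrite !cat_rcons act_below fr act1.
Qed.

(** The orbit factors through the abelianization, which is generated by four involutions and so has
    at most 16 elements. *)
Lemma abelian_orbit_finite v y :
  (forall g h, rho (below_word v [~ g, h]) y = y) -> finite_set (orb v y).
Proof.
move=> H; pose r g := rho (below_word v g).
have rM g h z : r (g * h) z = r g (r h z) by rewrite /r below_wordM rhoM.
have rC g h : r (g * h) y = r (h * g) y.
  by rewrite commgC rM [r [~ _, _] y]H.
pose P l (i : 'I_4 -> bool) : G :=
  foldr (fun s g => (if i s then gen s else 1) * g) 1 l.
have Pext l i j : {in l, i =1 j} -> P l i = P l j.
  elim: l => //= s l IH ij; rewrite ij ?inE ?eqxx // IH // => t tl.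
  by apply: ij; rewrite inE tl orbT.
have PS t l i : P (t :: l) i = (if i t then gen t else 1) * P l i by [].
have step l s i : uniq l -> s \in l -> exists j, r (gen s * P l i) y = r (P l j) y.
  elim: l => // t l IH /andP[tl ul]; rewrite inE.
  have upd (b : bool) j : P l (fun z => if z == t then b else j z) = P l j.
    apply: Pext => z zl; case: eqVneq => // zt.
    by rewrite zt (negPf tl) in zl.
  have [-> _|st sl] := eqVneq s t.
    exists (fun z => if z == t then ~~ i t else i z).
    rewrite !PS upd eqxx mulgA; congr (r (_ * _) y).
    by case: (i t); rewrite /= ?mulg1 // -{1}genV mulVg.
  have [j jP] := IH ul sl.
  exists (fun z => if z == t then i t else j z).
  rewrite !PS upd eqxx [RHS]rM -jP -rM.
  set z := if i t then _ else _.
  (* Commutativity is known only at [y], so [gen s] passes [z] in two swaps: to the far right, then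
     back in front of [P l i]. *)
  by rewrite rC -mulgA !rM; congr (r z _); rewrite -!rM rC.
apply: (sub_finite_set (B := (fun i : {ffun 'I_4 -> bool} => r (P genlist i) y)
                              @` setT)); last first.
  by apply: finite_image; apply: finite_finset.
move=> _ [g ->]; elim/gen_ind: g => [|s g [i _ Ei]].
  by exists [ffun=> false] => //; congr (r _ y); rewrite /P /= !ffunE !mulg1.
have [j Ej] := step genlist s i isT (mem_genlist s).
exists (finfun j) => //.
rewrite below_wordM rhoM -Ei -/(r _) -rM Ej.
by congr (r _ y); rewrite /P /= !ffunE.
Qed.

(** By [bad_split], [y] would be bad at pairwise incomparable [p], [p'], [v]. Deep below [p], every
    commutator is [[~ k1, k2]] transported to [p], where [k1] and [k2] move [y] as elements of the
    copies at [p'] and [v] do. These commute, so the commutator fixes [y] and [abelian_orbit_finite]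
    applies. *)
Lemma bad_disjoint u v y : incomp u v -> bad u y -> ~ bad v y.
Proof.
move=> uv bu bv; have [p [p' [pp' pv p'v bp bp']]] := bad_split uv bu bv.
have Kn := normal_subgroupI (orb_kernel_normal pp') (orb_kernel_normal pv).
have [m mP] := nsub_comm_level Kn
  (finite_indexI (orb_kernel_finite_index pp') (orb_kernel_finite_index pv)).
have [w sw bw] := chain_level m bp.
apply: (bad_inf bw); apply: abelian_orbit_finite => g h.
have [k1 [k2 [[K1 _] [_ K2] E]]] := mP w sw g h.
rewrite below_word_cat E below_wordR.
have [a Ea] := K1 y bp'; have [b Eb] := K2 y bv.
set c1 := below_word p k1 in Ea *; set c2 := below_word p k2 in Eb *.
have cb : commute c1 (below_word v b) by apply: below_commute.
have ca : commute c2 (below_word p' a) by apply: below_commute.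
have cab : commute (below_word p' a) (below_word v b) by apply: below_commute.
suff E' : rho (c1 * c2) y = rho (c2 * c1) y.
  rewrite commgC rhoM in E'.
  by apply: (can_inj (rhoK (c2 * c1))).
by rewrite rhoM Eb -rhoM cb rhoM Ea -rhoM -cab rhoM -Eb -rhoM -ca rhoM -Ea -rhoM.
Qed.

Lemma incomp_orb_finite u v y : incomp u v -> bad v y -> finite_set (orb u y).
Proof.
move=> uv bv; have [bu|//] := dichotomy rhoP AP uv bv.
by case: (bad_disjoint uv bu bv).
Qed.

End Disjoint.

(** * Rows and columns of the carpet *)

(** A generator stops acting after the first letter off its side. *)
Lemma gen_act_not_side s v : ~~ all (side s) v ->
  forall u, act (gen s) (v ++ u) = act (gen s) v ++ u.
Proof.
elim: v => //= x v IH vs u; rewrite !gen_act; case: ifP vs => //= _ vs.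
by rewrite IH.
Qed.

Lemma gen_act_side s v u : all (side s) v ->
  act (gen s) (v ++ u) = v ++ act (gen s) u.
Proof.
elim: v => //= x v IH /andP[xs /IH E].
by rewrite gen_act xs E side_gperm.
Qed.

Lemma gen_act_moves s v : act (gen s) v != v ->
  forall u, act (gen s) (v ++ u) = act (gen s) v ++ u.
Proof.
move=> ne; apply: gen_act_not_side; apply: contra ne => vs.
by rewrite -{1}[v]cats0 gen_act_side // gen_act0 cats0.
Qed.

(* The strips for [(gb, gd)] and [(ga, gc)] are the rows and the columns of the
   carpet that cross no hole. *)
Definition strip (e1 e2 : 'I_4) (bs : seq bool) (v : seq X) : bool :=
  all2 (fun b x => side (if b then e1 else e2) x) bs v.

Section Lines.
Variables h1 h2 e1 e2 : 'I_4.
Hypothesis hP : (h1, h2, e1, e2) \in [:: (ga, gc, gb, gd); (gb, gd, ga, gc)].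
Let e (b : bool) := if b then e1 else e2.

Lemma line_gperm b s x : s \in [:: h1; h2] ->
  side (e b) x -> side (e b) (gperm s x).
Proof.
move=> sh; apply/implyP; move: x; apply: letters_all; move: s sh; apply/allP.
by rewrite /e; move: hP; rewrite !inE => /orP[] /eqP[-> -> -> ->];
  case: b; vm_compute.
Qed.

(** A line has three letters; each of [h1], [h2] swaps one adjacent pair and fixes the remaining
    letter. *)
Lemma line_path b x y : side (e b) x -> side (e b) y -> exists s t,
  [/\ s \in [:: h1; h2], t \in [:: h1; h2] & gperm t (gperm s x) = y].
Proof.
move=> xe ye.
suff /hasP [s sh /hasP [t th /eqP E]] : has (fun s => has (fun t =>
    gperm t (gperm s x) == y) [:: h1; h2]) [:: h1; h2] by exists s, t.
move: ye; apply/implyP; move: y; apply: letters_all; move: xe; apply/implyP.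
move: x; apply: letters_all.
by rewrite /e; move: hP; rewrite !inE => /orP[] /eqP[-> -> -> ->];
  case: b; vm_compute.
Qed.

Lemma line_end b s : s \in [:: h1; h2] -> exists x, side (e b) x && side s x.
Proof.
move=> sh; suff /hasP [x _ xP] : has (fun x => side (e b) x && side s x) letters.
  by exists x.
move: s sh; apply/allP.
by rewrite /e; move: hP; rewrite !inE => /orP[] /eqP[-> -> -> ->];
  case: b; vm_compute.
Qed.

Lemma line_disjoint b b' x : side (e b) x -> side (e b') x -> b = b'.
Proof.
move=> xb xb'; apply/eqP; move: xb'; apply/implyP; move: xb; apply/implyP.
move: x; apply: letters_all.
by rewrite /e; move: hP; rewrite !inE => /orP[] /eqP[_ _ -> ->];
  case: b; case: b'; vm_compute.
Qed.

Notation strip := (strip e1 e2).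

Lemma strip_cons b bs x v : strip (b :: bs) (x :: v) = side (e b) x && strip bs v.
Proof. by []. Qed.

Lemma strip_size bs v : strip bs v -> size v = size bs.
Proof. by elim: bs v => [|b bs IH] [|x v] //= /andP[_ /IH ->]. Qed.

Lemma strip_inj bs bs' v : strip bs v -> strip bs' v -> bs = bs'.
Proof.
elim: bs bs' v => [|b bs IH] [|b' bs'] [|x v] //.
rewrite !strip_cons => /andP[xb vb] /andP[xb' vb'].
by rewrite (line_disjoint xb xb') (IH _ _ vb vb').
Qed.

Lemma strip_gen bs s v : s \in [:: h1; h2] -> strip bs v ->
  strip bs (act (gen s) v).
Proof.
move=> sh; elim: bs v => [|b bs IH] [|x v] //; first by rewrite gen_act0.
rewrite strip_cons gen_act strip_cons => /andP[xb vb].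
by rewrite line_gperm //=; case: ifP => _ //; apply: IH.
Qed.

Lemma strip_end bs s : s \in [:: h1; h2] ->
  exists v, strip bs v && all (side s) v.
Proof.
move=> sh; elim: bs => [|b bs [v /andP[vb vs]]]; first by exists [::].
have [x /andP[xb xs]] := line_end b sh.
by exists (x :: v); rewrite strip_cons xb vb /= xs vs.
Qed.

(* The shape of the induction: within a block [x :: _], moving [w] to
   [act (gen s) w] means moving [x] to the side [s] first. *)
Lemma strip_connected bs (L : seq X -> seq X -> Prop) :
  (forall v, strip bs v -> L v v) ->
  (forall v w t, L v w -> L w t -> L v t) ->
  (forall v s, strip bs v -> s \in [:: h1; h2] -> act (gen s) v != v ->
     L v (act (gen s) v)) ->
  forall v w, strip bs v -> strip bs w -> L v w.
Proof.
elim: bs L => [|b bs IH] L Lrefl Ltrans Lstep [|x v] [|y w] //.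
  by move=> n _; apply: Lrefl.
have sub z z' t : side (e b) z -> side (e b) z' -> strip bs t ->
    L (z :: t) (z' :: t).
  move=> zb zb' tb; have [s [s' [sh sh' <-]]] := line_path zb zb'.
  have one u r : side (e b) u -> r \in [:: h1; h2] -> L (u :: t) (gperm r u :: t).
    move=> ub rh; have ut : strip (b :: bs) (u :: t) by rewrite strip_cons ub.
    have [->|ne] := eqVneq (gperm r u) u; first exact: Lrefl.
    have E : act (gen r) (u :: t) = gperm r u :: t.
      rewrite gen_act; case: ifP => // /side_gperm E.
      by rewrite E eqxx in ne.
    rewrite -E; apply: Lstep => //; rewrite E.
    by apply: contra ne => /eqP [->].
  apply: Ltrans (one _ _ zb sh) (one _ _ _ sh').
  exact: line_gperm.
rewrite !strip_cons => /andP[xb vb] /andP[yb wb].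
pose L' t t' := strip bs t /\ strip bs t' /\ forall z z',
  side (e b) z -> side (e b) z' -> L (z :: t) (z' :: t').
suff [_ [_]] : L' v w by apply.
apply: (IH L') vb wb => {v w x y xb yb}.
- by move=> v vb; do 2!split=> //; move=> z z' zb zb'; apply: sub.
- move=> v w t [vb [wb vw]] [_ [tb wt]]; do 2!split=> //.
  move=> z z' zb zb'; exact: Ltrans (vw _ _ zb zb) (wt _ _ zb zb').
move=> v s vb sh ne; have svb := strip_gen sh vb.
do 2!split=> //; move=> z z' zb zb'.
have [x /andP[xb xs]] := line_end b sh.
have E : act (gen s) (x :: v) = x :: act (gen s) v.
  by rewrite gen_act xs side_gperm.
apply: (Ltrans _ _ _ (sub _ _ _ zb xb vb)).
apply: (Ltrans _ _ _ _ (sub _ _ _ xb zb' svb)).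
rewrite -E; apply: Lstep => //; first by rewrite strip_cons xb.
by rewrite E; apply: contra ne => /eqP [->].
Qed.

End Lines.

Lemma strips_meet bs bs' : size bs = size bs' ->
  exists v, strip gb gd bs v && strip ga gc bs' v.
Proof.
elim: bs bs' => [|b bs IH] [|b' bs'] //; first by exists [::].
move=> [/IH [v /andP[vb vb']]].
suff /hasP [x _ /andP[xb xb']] : has (fun x =>
    side (if b then gb else gd) x && side (if b' then ga else gc) x) letters.
  by exists (x :: v); rewrite !strip_cons xb xb' vb.
by case: b; case: b'; vm_compute.
Qed.

(** * Sections that preserve the commensurated set, and Property FW *)

Section Transfixed.
Variables (Y : eqType) (rho : G -> Y -> Y).
Hypothesis rhoP : is_left_action rho.
Variable A : set Y.
Hypothesis AP : commensurated rho A.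

Notation orb := (orb rho).
Notation bad := (bad rho A).
Notation moved := (moved rho A).

Let rho1 := rho1 rhoP.
Let rhoM := rhoM rhoP.
Let rhoK := rhoK rhoP.
Let rhoKV := rhoKV rhoP.

Definition fixator v : set G := [set h | forall u, act h (v ++ u) = v ++ u].

(** Induction along [v]. An element of the fixator of [x :: v] is a rigid factor times grafts: the
    graft at [x] comes from the fixator of [v], and the grafts at other letters have finite orbits
    by [incomp_orb_finite]. *)
Lemma fixator_orbit_finite p v y : bad (p ++ v) y ->
  finite_set [set z | exists2 h, fixator v h & z = rho (below_word p h) y].
Proof.
elim: v p => [|x v IH] p.
  move=> _; apply: sub_finite_set (finite_set1 y) => _ [h hf ->].
  rewrite (_ : h = 1) ?below_word1 ?rho1 //.
  by apply: act_ext => u; apply: hf.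
rewrite -cat_rcons => bp; have F1 := IH _ bp.
have F2 : finite_set [set z | exists k t, [/\
    exists2 h, fixator v h & t = rho (below_word (rcons p x) h) y &
    z = rho (below_word p (grafts (rem x letters) k)) t]].
  apply: (sub_finite_set (B := \bigcup_(t in [set t |
      exists2 h, fixator v h & t = rho (below_word (rcons p x) h) y])
    [set z | exists k, z = rho (below_word p (grafts (rem x letters) k)) t])).
    by move=> _ [k [t [ht ->]]]; exists t => //; exists k.
  apply: bigcup_finite => // _ [h _ ->].
  apply: grafts_finite => [||x']; rewrite ?rem_uniq //.
  rewrite mem_rem_letters => xx'.
  have inc : incomp (rcons p x') (rcons p x).
    by rewrite -!cats1 incomp_cat; apply: incomp_size; rewrite //= eqseq_cons andbT.
  apply: orb_commute_finite => //.
    by move=> g; apply: below_commute; rewrite incomp_sym.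
  apply: (incomp_orb_finite rhoP AP _ bp).
  by rewrite incomp_sym; apply: incomp_catl; rewrite incomp_sym.
apply: sub_finite_set (rigid_finite rho p F2) => _ [h hf ->].
have [f [r [k [fr hE E]]]] := wreath_prod h.
exists f, r, (rho (below_word p (grafts (rem x letters) k * graft x (k x))) y).
split=> //; last by rewrite -rhoM -below_wordM -E.
exists k, (rho (below_word (rcons p x) (k x)) y); split.
  by exists (k x) => // u; have := hf u; rewrite /= hE => -[].
by rewrite below_wordM rhoM below_rcons.
Qed.

(* The fixator of the subtree at [v] has finite orbits on a bad orbit at [v],
   and almost all of them lie in [A] or in its complement.  An element [j] as in
   the hypothesis agrees with [below_word v g] up to the fixator, so it would
   carry such an orbit in [A] to one in the complement. *)
Lemma section_not_bad v :
  (forall g, exists j, (forall u, act j (v ++ u) = v ++ act g u) /\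
     forall z, bad v z -> (A z <-> A (rho j z))) ->
  forall y, ~ bad v y.
Proof.
move=> sec y b; have [Ai Aic] := b.
have fixC h : fixator v h -> forall g, commute h (below_word v g).
  move=> hf g; have E : forall u, act h (v ++ u) = v ++ act 1 u by move=> u; rewrite hf.
  by rewrite /commute (below_conj _ E) mul1g invg1 mulg1.
have fin := @fixator_orbit_finite [::] v y b.
have /choice [c cP] : forall z, exists h,
    (exists2 h, fixator v h & z = rho h y) -> fixator v h /\ z = rho h y.
  move=> z; have [[h hf ->]|n] := pselect (exists2 h, fixator v h & z = rho h y).
    by exists h.
  by exists 1 => /n.
pose E : set Y := \bigcup_(z in [set z | exists2 h, fixator v h & z = rho h y])
  moved (c z).
have Efin : finite_set E.
  by apply: bigcup_finite => // z _; apply: finite_moved.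
have pick S : infinite_set S -> exists2 t, S t & ~ E t.
  move=> Si; apply: contrapT => nt; apply: Si; apply: sub_finite_set Efin.
  by move=> t St; apply: contrapT => nE; apply: nt; exists t.
have [y1 [o1 A1] E1] := pick _ Ai; have [y2 [o2 A2] E2] := pick _ Aic.
have [g Eg] : orb v y1 y2 by rewrite (orb_eq rhoP o1).
have [j [jE jA]] := sec g.
have Aj : A (rho j y1) by apply/(jA y1) => //; apply: bad_orb b.
have [h [hf hy2]] : exists h, fixator v h /\ rho j y1 = rho h y2.
  exists (j * (below_word v g)^-1); split; last by rewrite Eg -rhoM mulgVK.
  by move=> u; rewrite actM -below_wordV act_below jE actKV.
have hy : exists2 h0, fixator v h0 & rho h y = rho h0 y by exists h.
have [cf cE] := cP _ hy.
have hy2' : rho h y2 = rho (c (rho h y)) y2.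
  have [g2 ->] := o2.
  by rewrite -!rhoM (fixC _ hf) (fixC _ cf) !rhoM -cE.
apply: E2; exists (rho h y) => //.
by move=> [_ back]; apply: A2; apply: back; rewrite -hy2' -hy2.
Qed.

Definition hit v : Prop := exists2 z, boundary rho A [::] z & bad v z.

Definition linked v w : Prop := exists j, (forall u, act j (v ++ u) = w ++ u) /\
  forall z, bad v z -> (A z <-> A (rho j z)).

Lemma linked_refl v : linked v v.
Proof. by exists 1; split=> [u|z _]; rewrite ?act1 ?rho1. Qed.

Lemma linked_trans v w t : linked v w -> linked w t -> linked v t.
Proof.
move=> [j [jE jA]] [k [kE kA]]; exists (k * j); split=> [u|z bz].
  by rewrite actM jE kE.
by rewrite rhoM (jA z bz); apply: kA; apply: (bad_section rhoP AP (k := 1)) bz.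
Qed.

Lemma unhit_gen v s : ~ hit v -> forall z, bad v z ->
  (A z <-> A (rho (gen s) z)).
Proof.
move=> nh z bz; apply: contrapT => m; apply: nh; exists z => //.
by exists s.
Qed.

Section Strip.
Variables h1 h2 e1 e2 : 'I_4.
Hypothesis hP : (h1, h2, e1, e2) \in [:: (ga, gc, gb, gd); (gb, gd, ga, gc)].

(* The bad sets at distinct vertices of one level are disjoint, so the finite
   boundary of [A] cannot meet all of the [2 ^ k] pairwise disjoint strips. *)
Lemma unhit_strip D k : boundary rho A [::] = [set` D] -> size D < 2 ^ k ->
  exists2 bs, size bs = k & forall v, strip e1 e2 bs v -> ~ hit v.
Proof.
move=> DE sD; apply: contrapT => nex.
have /choice [F FP] : forall t : k.-tuple bool, exists z,
    z \in D /\ exists2 v, strip e1 e2 t v & bad v z.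
  move=> t; apply: contrapT => nz; apply: nex; exists t; first exact: size_tuple.
  move=> v tv [z zD bz]; apply: nz; exists z; split; last by exists v.
  by rewrite DE in zD.
have Finj : injective F.
  move=> t t' E; have [_ [v tv bv]] := FP t; have [_ [v' tv' bv']] := FP t'.
  apply: val_inj; rewrite -E in bv'.
  have [vv'|vv'] := eqVneq v v'; first by rewrite -vv' in tv'; exact: (strip_inj hP tv tv').
  case: (bad_disjoint rhoP AP _ bv bv'); apply: incomp_size => //.
  by rewrite (strip_size tv) (strip_size tv') !size_tuple.
have : size (map F (enum {: k.-tuple bool})) <= size D.
  apply: uniq_leq_size; first by rewrite map_inj_uniq ?enum_uniq.
  by move=> _ /mapP [t _ ->]; case: (FP t).
by rewrite size_map -cardE card_tuple card_bool leqNgt sD.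
Qed.

(** Walk along the strip to an end [w] on side [s], where [gen s] has section [gen s], and return by
    the inverse path. No vertex on the way is hit, so bad points never enter or leave [A]. *)
Lemma strip_loop bs v s : (forall v, strip e1 e2 bs v -> ~ hit v) ->
  strip e1 e2 bs v -> s \in [:: h1; h2] ->
  exists j, (forall u, act j (v ++ u) = v ++ act (gen s) u) /\
    forall z, bad v z -> (A z <-> A (rho j z)).
Proof.
move=> nh bv sh; have [w /andP[bw ws]] := strip_end hP bs sh.
have [j [jE jA]] : linked v w.
  apply: (strip_connected hP) bv bw => [t _|t t' t''|t r bt rh ne].
  - exact: linked_refl.
  - exact: linked_trans.
  exists (gen r); split; last exact: unhit_gen (nh _ bt).
  exact: gen_act_moves.
have jV u : act j^-1 (w ++ u) = v ++ u by rewrite -jE actK.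
exists (j^-1 * gen s * j); split=> [u|z bz].
  by rewrite !actM jE gen_act_side // jV.
have b1 : bad w (rho j z) by apply: (bad_section rhoP AP (k := 1)) bz.
have b2 : bad w (rho (gen s) (rho j z)).
  by apply: (bad_section rhoP AP (k := gen s)) b1 => u; apply: gen_act_side.
have b3 : bad v (rho j^-1 (rho (gen s) (rho j z))).
  by apply: (bad_section rhoP AP (k := 1)) b2.
rewrite !rhoM (jA z bz) (unhit_gen s (nh _ bw) b1) (jA _ b3).
by rewrite rhoKV.
Qed.

End Strip.

Lemma not_bad_root y : ~ bad [::] y.
Proof.
move=> b; have /finite_seqP [D DE] := finite_boundary rhoP AP [::].
(* Level [size D] already has more strips in each direction than [D] has entries. *)
have lt := ltn_expl (size D) (isT : 1 < 2).
have rowP : (ga, gc, gb, gd) \in [:: (ga, gc, gb, gd); (gb, gd, ga, gc)] by [].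
have colP : (gb, gd, ga, gc) \in [:: (ga, gc, gb, gd); (gb, gd, ga, gc)] by [].
have [bs sbs nh] := unhit_strip rowP DE lt.
have [bs' sbs' nh'] := unhit_strip colP DE lt.
have [v /andP[rv cv]] := strips_meet (etrans sbs (esym sbs')).
have [w sw bw] := chain_level rhoP AP (size D) b.
have [z bz] : exists z, bad v z.
  by apply: (bad_level rhoP AP) bw; rewrite sw (strip_size rv).
apply: (section_not_bad _ bz); elim/gen_ind => [|s g [j [jE jA]]].
  by exists 1; split=> [u|t _]; rewrite ?act1 ?rho1.
have [i [iE iA]] : exists i, (forall u, act i (v ++ u) = v ++ act (gen s) u) /\
    forall z, bad v z -> (A z <-> A (rho i z)).
  have /orP [sr|sc] : (s \in [:: ga; gc]) || (s \in [:: gb; gd]).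
    by move: s; apply: gens_all; vm_compute.
  - exact: (strip_loop rowP nh rv sr).
  - exact: (strip_loop colP nh' cv sc).
exists (i * j); split=> [u|t bt]; first by rewrite !actM jE iE.
rewrite rhoM (jA t bt); apply: iA.
exact: (bad_section rhoP AP (k := g)) bt.
Qed.

Lemma commensurated_transfixed : transfixed rho A.
Proof.
(* [B] collects the infinite orbits almost contained in [A] and the finite ones contained in it.
   Orbits off the boundary lie in both sets or miss both; each of the finitely many others meets the
   difference in a finite set because it is not bad. *)
pose B := [set y | finite_set (orb [::] y `\` A) /\
                   (finite_set (orb [::] y) -> orb [::] y `<=` A)].
have Borb y z : orb [::] y z -> B y -> B z by rewrite /B /= => /(orb_eq rhoP) ->.
exists B; split=> [g|].
  apply/seteqP; split=> [_ [y By <-]|y By].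
    by apply: (Borb _ _ _ By); exists g.
  exists (rho g^-1 y); last by rewrite rhoKV.
  by apply: Borb By; exists g^-1.
apply: (sub_finite_set (B := \bigcup_(d in boundary rho A [::])
   (orb [::] d `&` (A `+` B)))).
  move=> y yAB; suff [d bd yd] : exists2 d, boundary rho A [::] d & orb [::] y d.
    by exists d => //; split=> //; apply: (orb_sym rhoP).
  apply: contrapT => nb.
  have ub : forall z, orb [::] y z -> (A z <-> A y).
    by apply: (unbroken rhoP) => z yz bz; apply: nb; exists z.
  have yy := orb_refl rhoP [::] y.
  case: yAB => [[Ay nBy]|[[fin sub] nAy]].
    apply: nBy; split; last by move=> _ z /ub [_]; apply.
    apply: sub_finite_set (finite_set0 _) => z [/ub [_ E] nAz].
    exact/nAz/E.
  have := nAy; apply; apply: sub => //; apply: sub_finite_set fin => z yz.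
  by split=> // /(ub z yz).
apply: bigcup_finite => [|d _]; first exact: finite_boundary.
have [fd|id] := pselect (finite_set (orb [::] d)); first exact: finite_setIl.
have /not_andP [/contrapT fin|/contrapT fin] := @not_bad_root d.
  apply: (sub_finite_set _ fin) => y [dy [[Ay _]|[[fy _] _]]]; first by split.
  rewrite (orb_eq rhoP dy) in fy; case: id.
  apply: (sub_finite_set (B := (orb [::] d `&` A) `|` (orb [::] d `\` A))).
    by move=> z dz; have [Az|nAz] := pselect (A z); [left|right].
  by rewrite finite_setU.
apply: (sub_finite_set _ fin) => y [dy [[_ nBy]|[_ nAy]]]; last by split.
by case: nBy; split; rewrite (orb_eq rhoP dy).
Qed.

End Transfixed.

Theorem carpet_group_FW : property_FW carpet_group.
Proof.
move=> Y rho rhoP A AP.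
exact: (@commensurated_transfixed {classic Y} rho rhoP A AP).
Qed.

Local Open Scope ring_scope.

(** * Amenability from the random walk *)

Section Ultralimit.
Variables (R : realType) (U : set_system nat).
Hypothesis UU : UltraFilter U.

Definition ulim (u : nat -> R) (l : R) : Prop :=
  forall e, 0 < e -> U [set n | `|u n - l| <= e].

(** The limit is the supremum of the [x] with [x <= u n] for [U]-almost all [n]. *)
Lemma ulim_ex (u : nat -> R) : (forall n, 0 <= u n <= 1) -> exists l, ulim u l.
Proof.
move=> u01; pose S := [set x | U [set n | x <= u n]].
have S0 : S 0.
  by rewrite /S /= (_ : [set _ | _] = setT) ?predeqE; [exact: filterT |
     move=> n; split=> // _; case/andP: (u01 n)].
have S1 : ubound S 1.
  by move=> x /filter_ex [n /= xn]; apply: le_trans xn _; case/andP: (u01 n).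
have Sup : has_sup S by split; [exists 0|exists 1].
exists (sup S) => e e0.
have [x Sx xe] := sup_adherent e0 Sup.
have [Se|nSe] := in_ultra_setVsetC [set n | sup S + e <= u n] UU.
  by have := sup_upper_bound Sup Se; rewrite gerDl leNgt e0.
apply: filterS (filterI Sx nSe) => n [/= xn /negP]; rewrite -ltNge => un.
by rewrite ler_distlC; apply/andP; split; lra.
Qed.

Lemma ulim_eq (u v : nat -> R) l m : ulim u l -> ulim v m ->
  (forall e : R, 0 < e -> U [set n | `|u n - v n| <= e]) -> l = m.
Proof.
move=> ul vm uv; apply/eqP; rewrite -subr_eq0 -normr_le0.
apply/ler_addgt0Pr => e e0; rewrite add0r; have e3 : 0 < e / 3 by lra.
have [n [[/= h1 h2] h3]] : exists n, ([set n | `|u n - l| <= e / 3] `&`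
    [set n | `|v n - m| <= e / 3] `&` [set n | `|u n - v n| <= e / 3]) n.
  apply: (@filter_ex _ U); apply: filterI; last exact: uv.
  by apply: filterI; [exact: ul|exact: vm].
by move: h1 h2 h3; rewrite !ler_norml => /andP[? ?] /andP[? ?] /andP[? ?]; lra.
Qed.

Lemma ulimD (u v : nat -> R) l m :
  ulim u l -> ulim v m -> ulim (fun n => u n + v n) (l + m).
Proof.
move=> ul vm e e0; have e2 : 0 < e / 2 by lra.
apply: filterS (filterI (ul _ e2) (vm _ e2)) => n [/=].
by rewrite !ler_norml => /andP[? ?] /andP[? ?]; lra.
Qed.

Lemma ulim_ge0 (u : nat -> R) l : (forall n, 0 <= u n) -> ulim u l -> 0 <= l.
Proof.
move=> u0 ul; rewrite leNgt; apply/negP => l0.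
have /filter_ex [n /=] : U [set n | `|u n - l| <= - l / 2] by apply: ul; lra.
by have := u0 n; rewrite ler_norml => ? /andP[? ?]; lra.
Qed.

Lemma ulim_uniq (u v : nat -> R) l m : u =1 v -> ulim u l -> ulim v m -> l = m.
Proof.
move=> uv ul vm; apply: ulim_eq ul vm _ => e e0.
rewrite (_ : [set _ | _] = setT); first exact: filterT.
by rewrite predeqE => n; split=> // _ /=; rewrite uv subrr normr0 ltW.
Qed.

Lemma ulim_cst (c : R) : ulim (fun=> c) c.
Proof.
move=> e e0; rewrite (_ : [set _ | _] = setT); first exact: filterT.
by rewrite predeqE => n; split=> // _ /=; rewrite subrr normr0 ltW.
Qed.

End Ultralimit.

(** An ultralimit of the [phi] is additive and exactly invariant under the generators; the first
    hypothesis extends the invariance to the group. *)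
Lemma amenable_of_almost_invariant (R : realType) (G : groupType) (I : Type)
    (gen : I -> G) :
  (forall P : G -> Prop, P 1%g -> (forall s g, P g -> P (gen s * g)%g) ->
     forall g, P g) ->
  (forall d : R, 0 < d -> exists phi : set G -> R,
    [/\ forall A, 0 <= phi A, phi setT = 1,
        forall A B, A `&` B = set0 -> phi (A `|` B) = phi A + phi B &
        forall s A, `|phi [set (gen s * x)%g | x in A] - phi A| <= d]) ->
  amenable R G.
Proof.
move=> gen_ind almost.
have /choice [phi phiP] : forall k : nat, exists phi : set G -> R,
    [/\ forall A, 0 <= phi A, phi setT = 1,
        forall A B, A `&` B = set0 -> phi (A `|` B) = phi A + phi B &
        forall s A, `|phi [set (gen s * x)%g | x in A] - phi A| <= k.+1%:R^-1].
  by move=> k; apply: almost; rewrite invr_gt0 ltr0Sn.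
have [U [UU oU]] := ultraFilterLemma (_ : ProperFilter \oo).
have phi01 A k : 0 <= phi k A <= 1.
  have [p0 p1 pD _] := phiP k; rewrite p0 -p1 -(setUv A) pD ?setICr //.
  by rewrite lerDl p0.
have /choice [mu muP] : forall A, exists l, ulim U (fun k => phi k A) l.
  by move=> A; apply: ulim_ex.
have mu_gen s A : mu [set (gen s * x)%g | x in A] = mu A.
  apply: ulim_eq (muP _) (muP A) _ => e e0; apply: oU.
  exists (Num.truncn e^-1) => //= k /= ke; have [_ _ _ /(_ s A)] := phiP k.
  move/le_trans; apply; rewrite -[e]invrK lef_pV2 ?posrE ?invr_gt0 ?ltr0Sn //.
  apply: (le_trans (ltW (truncnS_gt _))).
  by rewrite ler_nat ltnS.
exists mu; split.
- by move=> A; apply: ulim_ge0 (muP A) => k; have [] := phiP k.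
- by apply: ulim_uniq (muP setT) (ulim_cst _ 1) => k; have [] := phiP k.
- move=> A B AB; apply: ulim_uniq (muP _) (ulimD UU (muP A) (muP B)) => k.
  by have [_ _ ->] := phiP k.
- apply: gen_ind => [A|s g IH A].
    by rewrite (_ : image _ _ = A) // predeqE => x; split=> [[y Ay <-]|Ax];
      [rewrite mul1g|exists x; rewrite ?mul1g].
  rewrite -(IH A) -(mu_gen s [set (g * x)%g | x in A]); congr mu; rewrite predeqE => x; split.
    by move=> [y Ay <-]; exists (g * y)%g; [exists y|rewrite mulgA].
  by move=> [_ [y Ay <-] <-]; exists y; rewrite // mulgA.
Qed.

(** * Kesten's criterion *)

Fixpoint words (I : finType) (n : nat) : seq (seq I) :=
  if n is m.+1 then [seq s :: w | s <- enum I, w <- words I m] else [:: [::]].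

Lemma sum_wordsS (I : finType) (V : nmodType) n (F : seq I -> V) :
  \sum_(w <- words I n.+1) F w = \sum_s \sum_(w <- words I n) F (s :: w).
Proof. by rewrite big_allpairs_dep /= big_enum. Qed.

Lemma size_words (I : finType) n : size (words I n) = (#|I| ^ n)%N.
Proof. by elim: n => //= n IH; rewrite size_allpairs IH -cardE expnS. Qed.

Lemma mem_wordsS (I : finType) n s (w : seq I) :
  w \in words I n -> s :: w \in words I n.+1.
Proof. by move=> wn; apply: allpairs_f => //; rewrite mem_enum. Qed.

Section Kesten.
Variables (R : realType) (G : groupType) (I : finType) (gen : I -> G) (s0 : I).
Hypothesis gen_s0 : gen s0 = 1%g.

Definition word_prod (w : seq I) : G := foldr (fun s g => (gen s * g)%g) 1%g w.

(** Up to the factor [#|I| ^ (2 n)], the squared l2 norm of the distribution of the walk of length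
    [n]. *)
Definition coincidences n : R :=
  \sum_(w <- words I n) \sum_(w' <- words I n) (word_prod w == word_prod w')%:R.

Lemma coincidencesS n : coincidences n.+1 =
  \sum_s \sum_t \sum_(w <- words I n) \sum_(w' <- words I n)
    ((gen s * word_prod w)%g == (gen t * word_prod w')%g)%:R.
Proof.
rewrite /coincidences sum_wordsS; apply: eq_bigr => s _.
under eq_bigr => w _ do rewrite sum_wordsS.
by rewrite exchange_big.
Qed.

Section Level.
Variable n : nat.
Notation W := (words I n).
Notation c := (coincidences n).

Definition multiplicity (g : G) : R := \sum_(w <- W) (word_prod w == g)%:R.
Notation f := multiplicity.

Definition reached : seq G := undup [seq word_prod w | w <- words I n.+1].

Lemma reached_mem s w : w \in W -> (gen s * word_prod w)%g \in reached.
Proof.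
move=> wn; rewrite mem_undup; apply/mapP; exists (s :: w) => //.
exact: mem_wordsS.
Qed.

Lemma sum_reached s (H : G -> R) :
  \sum_(g <- reached) f ((gen s)^-1 * g)%g * H g =
  \sum_(w <- W) H (gen s * word_prod w)%g.
Proof.
under eq_bigr => g _ do rewrite mulr_suml.
rewrite exchange_big /= big_seq [RHS]big_seq; apply: eq_bigr => w wn.
rewrite (bigD1_seq (gen s * word_prod w)%g) ?reached_mem ?undup_uniq //=.
rewrite mulKg eqxx mul1r big1 ?addr0 // => g ne.
case: eqP => [E|]; last by rewrite mul0r.
by rewrite E mulVKg eqxx in ne.
Qed.

Lemma coincidencesE : c = \sum_(w <- W) f (word_prod w).
Proof.
by rewrite /c /f; apply: eq_bigr => w _; apply: eq_bigr => w' _; rewrite eq_sym.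
Qed.

Lemma coincidences_gt0 : 0 < c.
Proof.
have [w wn] : exists w, w \in W.
  elim: n => [|m [w wm]]; first by exists [::]; rewrite inE.
  by exists (s0 :: w); apply: mem_wordsS.
rewrite /c (big_rem w wn) /= (big_rem w wn) /= eqxx -addrA ltr_wpDr //.
by apply: addr_ge0; apply: sumr_ge0 => *; rewrite ?sumr_ge0 // => *; rewrite ler0n.
Qed.

Lemma sum_sqr s : \sum_(g <- reached) f ((gen s)^-1 * g)%g ^+ 2 = c.
Proof.
under eq_bigr => g _ do rewrite expr2.
rewrite (sum_reached s (fun g => f ((gen s)^-1 * g)%g)) coincidencesE.
by apply: eq_bigr => w _; rewrite mulKg.
Qed.

Lemma sum_cross s t :
  \sum_(g <- reached) f ((gen s)^-1 * g)%g * f ((gen t)^-1 * g)%g =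
  \sum_(w <- W) \sum_(w' <- W)
    ((gen s * word_prod w)%g == (gen t * word_prod w')%g)%:R.
Proof.
rewrite (sum_reached s (fun g => f ((gen t)^-1 * g)%g)).
apply: eq_bigr => w _; apply: eq_bigr => w' _; congr (_ %:R).
congr nat_of_bool; apply/eqP/eqP => [->|->]; by rewrite ?mulVKg ?mulKg.
Qed.

(** The squared distance of two translates is [2 * (c - D u t)], so each [c - D u t] is nonnegative.
    Over all pairs they add up to at most [eps * #|I| ^ 2 * c], which bounds each of them. *)
Lemma gen_displacement eps s : (1 - eps) * #|I|%:R ^+ 2 * c <= coincidences n.+1 ->
  \sum_(g <- reached) (f ((gen s)^-1 * g)%g - f g) ^+ 2 <=
  2 * eps * #|I|%:R ^+ 2 * c.
Proof.
move=> H; pose D s t := \sum_(g <- reached)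
  f ((gen s)^-1 * g)%g * f ((gen t)^-1 * g)%g.
have E u t : \sum_(g <- reached) (f ((gen u)^-1 * g)%g - f ((gen t)^-1 * g)%g) ^+ 2
    = 2 * (c - D u t).
  under eq_bigr => g _ do rewrite sqrrB.
  rewrite big_split sumrB /= sumrMnl !sum_sqr /D -mulr_natl; ring.
have Dc u t : 0 <= c - D u t.
  have : 0 <= 2 * (c - D u t) by rewrite -E; apply: sumr_ge0 => *; apply: sqr_ge0.
  lra.
have S : \sum_u \sum_t (c - D u t) = #|I|%:R ^+ 2 * c - coincidences n.+1.
  have -> : coincidences n.+1 = \sum_u \sum_t D u t.
    rewrite coincidencesS; apply: eq_bigr => u _; apply: eq_bigr => t _.
    by rewrite -sum_cross.
  under eq_bigr => u _ do rewrite sumrB.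
  rewrite sumrB !sumr_const; congr (_ - _).
  by rewrite -[LHS]mulr_natl -[X in _ * X]mulr_natl mulrA -expr2.
have -> : \sum_(g <- reached) (f ((gen s)^-1 * g)%g - f g) ^+ 2 = 2 * (c - D s s0).
  by rewrite -E; apply: eq_bigr => g _; rewrite gen_s0 invg1 mul1g.
have : c - D s s0 <= \sum_u \sum_t (c - D u t).
  rewrite (bigD1 s) //= (bigD1 s0) //= -addrA lerDl.
  by apply: addr_ge0; apply: sumr_ge0 => *; rewrite ?sumr_ge0.
by rewrite S; lra.
Qed.

(** A sum over words visits [g] once for each of its [f g] words, so this is the mean for the
    density [f ^+ 2 / c]. *)
Definition sqr_mean (A : set G) : R :=
  (\sum_(w <- W) f (word_prod w) * (`[< A (word_prod w) >])%:R) / c.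

Lemma sqr_meanE s A : sqr_mean A = (\sum_(g <- reached)
  f ((gen s)^-1 * g)%g ^+ 2 * (`[< A ((gen s)^-1 * g)%g >])%:R) / c.
Proof.
under eq_bigr => g _ do rewrite expr2 -mulrA.
rewrite (sum_reached s (fun g => f ((gen s)^-1 * g)%g *
  (`[< A ((gen s)^-1 * g)%g >])%:R)).
by congr (_ / _); apply: eq_bigr => w _; rewrite mulKg.
Qed.

Lemma sqr_mean_displacement eps d s A :
  (1 - eps) * #|I|%:R ^+ 2 * c <= coincidences n.+1 -> 0 < d ->
  2 * eps * #|I|%:R ^+ 2 <= d ^+ 2 ->
  `|sqr_mean [set (gen s * x)%g | x in A] - sqr_mean A| <= 3 * d.
Proof.
move=> H d0 Hd; have c0 := coincidences_gt0.
rewrite (sqr_meanE s0) (sqr_meanE s A) gen_s0 invg1 -mulrBl -sumrB.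
rewrite normrM [`|c^-1|]ger0_norm ?invr_ge0 ?(ltW c0) // ler_pdivrMr //.
apply: le_trans (ler_norm_sum _ _ _) _.
(* Weighted AM-GM bounds [|x ^+ 2 - y ^+ 2|] by [(x - y) ^+ 2 / (2 * d) + d / 2 * (x + y) ^+ 2]. The
   sum is at most [d / 2 * c + 2 * d * c], within [3 * d * c]. *)
apply: (@le_trans _ _ (\sum_(g <- reached)
   (d^-1 / 2 * (f ((gen s)^-1 * g)%g - f g) ^+ 2 +
    d / 2 * (2 * f ((gen s)^-1 * g)%g ^+ 2 + 2 * f ((gen s0)^-1 * g)%g ^+ 2)))).
  apply: ler_sum => g _; rewrite gen_s0 invg1 !mul1g.
  have -> : `[< [set (gen s * x)%g | x in A] g >] = `[< A ((gen s)^-1 * g)%g >].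
    apply: asbool_equiv_eq; split; first by move=> [x Ax <-]; rewrite mulKg.
    by move=> Ag; exists ((gen s)^-1 * g)%g; rewrite ?mulVKg.
  set x := f _; set y := f _; set b := nat_of_bool _.
  have b01 : b = 0%N \/ b = 1%N by rewrite /b; case: `[< _ >]; [right|left].
  apply: (@le_trans _ _ `|x ^+ 2 - y ^+ 2|).
    by case: b01 => ->; rewrite ?mulr0 ?mulr1 ?subrr ?normr0.
  have di : d * d^-1 = 1 by rewrite mulfV // gt_eqF.
  have di0 : 0 < d^-1 by rewrite invr_gt0.
  have : 0 <= d^-1 / 2 * ((x - y) - d * (x + y)) ^+ 2.
    by rewrite mulr_ge0 ?sqr_ge0 // divr_ge0 // ltW.
  have : 0 <= d^-1 / 2 * ((x - y) + d * (x + y)) ^+ 2.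
    by rewrite mulr_ge0 ?sqr_ge0 // divr_ge0 // ltW.
  have -> : d^-1 / 2 * ((x - y) - d * (x + y)) ^+ 2 = d^-1 / 2 * (x - y) ^+ 2 -
    (d * d^-1) * ((x - y) * (x + y)) + (d * d^-1) * (d / 2 * (x + y) ^+ 2).
    by field; rewrite gt_eqF.
  have -> : d^-1 / 2 * ((x - y) + d * (x + y)) ^+ 2 = d^-1 / 2 * (x - y) ^+ 2 +
    (d * d^-1) * ((x - y) * (x + y)) + (d * d^-1) * (d / 2 * (x + y) ^+ 2).
    by field; rewrite gt_eqF.
  have : 0 <= d / 2 * (x - y) ^+ 2 by rewrite mulr_ge0 ?sqr_ge0 // divr_ge0 // ltW.
  by rewrite di !mul1r ler_norml => *; apply/andP; split; nra.
rewrite big_split /= -!mulr_sumr big_split /= -!mulr_sumr !sum_sqr.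
have := gen_displacement s H; set E := \sum_(g <- _) _ => HE.
have HE' : E <= d ^+ 2 * c.
  by apply: le_trans HE _; rewrite -[2 * eps * _ * _]mulrA mulrA ler_pM2r //.
have : d^-1 / 2 * E <= d^-1 / 2 * (d ^+ 2 * c).
  by rewrite ler_wpM2l // divr_ge0 // invr_ge0 ltW.
have -> : d^-1 / 2 * (d ^+ 2 * c) = d / 2 * c by field; rewrite gt_eqF.
have : 0 <= d * c by rewrite mulr_ge0 // ltW.
lra.
Qed.

Lemma sqr_mean_ge0 A : 0 <= sqr_mean A.
Proof.
rewrite divr_ge0 ?(ltW coincidences_gt0) //.
by apply: sumr_ge0 => w _; rewrite mulr_ge0 // sumr_ge0.
Qed.

Lemma sqr_meanT : sqr_mean setT = 1.
Proof.
rewrite /sqr_mean; under eq_bigr => w _ do rewrite asboolT // mulr1.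
by rewrite -coincidencesE mulfV // gt_eqF // coincidences_gt0.
Qed.

Lemma sqr_meanU A B : A `&` B = set0 ->
  sqr_mean (A `|` B) = sqr_mean A + sqr_mean B.
Proof.
move=> AB; rewrite /sqr_mean -mulrDl -big_split /=; congr (_ / _).
apply: eq_bigr => w _; rewrite -mulrDr; congr (_ * _); rewrite asbool_or.
case: asboolP => a; case: asboolP => b; rewrite ?addr0 ?add0r //.
by have : (A `&` B) (word_prod w) by []; rewrite AB.
Qed.

End Level.

(* Kesten's criterion: if the return probabilities do not decay exponentially,
   the squares of the densities of the random walk are almost invariant. *)
Lemma kesten_amenable :
  (forall P : G -> Prop, P 1%g -> (forall s g, P g -> P (gen s * g)%g) ->
     forall g, P g) ->
  (forall eps : R, 0 < eps -> exists n,
     (1 - eps) * #|I|%:R ^+ 2 * coincidences n <= coincidences n.+1) ->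
  amenable R G.
Proof.
move=> gen_ind H; apply: (amenable_of_almost_invariant gen_ind) => d d0.
have I0 : 0 < #|I|%:R ^+ 2 :> R.
  by rewrite exprn_gt0 // ltr0n; apply/card_gt0P; exists s0.
have [|n nP] := H ((d / 3) ^+ 2 / 2 / #|I|%:R ^+ 2).
  by rewrite !divr_gt0 // exprn_gt0 // divr_gt0.
exists (sqr_mean n); split.
- exact: sqr_mean_ge0.
- exact: sqr_meanT.
- exact: sqr_meanU.
move=> s A; have -> : d = 3 * (d / 3) by field.
apply: sqr_mean_displacement nP _ _; first by rewrite divr_gt0.
rewrite -mulrA divfK ?gt_eqF //; lra.
Qed.

End Kesten.

(** * Lower bounds on coincidences from codes *)

Lemma sqr_sum_le (R : realFieldType) (F : finType) (N : F -> R) :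
  (\sum_k N k) ^+ 2 <= #|F|%:R * \sum_k N k ^+ 2.
Proof.
set S := \sum_k N k; set c : R := #|F|%:R.
have [F0|F0] := posnP #|F|.
  rewrite /S !big1 ?mulr0 ?expr0n // => k _;
  by have := card0_eq F0 k; rewrite !inE.
have c0 : 0 < c by rewrite ltr0n.
have : 0 <= \sum_k (c * N k - S) ^+ 2 by apply: sumr_ge0 => k _; apply: sqr_ge0.
have -> : \sum_k (c * N k - S) ^+ 2 = c * (c * (\sum_k N k ^+ 2) - S ^+ 2).
  under eq_bigr => k _ do rewrite sqrrB exprMn.
  rewrite big_split sumrB /= -mulr_sumr sumrMnl -mulr_suml -mulr_sumr -/S.
  rewrite sumr_const -[_ *+ #|_|]mulr_natl -/c -mulr_natl; ring.
by rewrite pmulr_rge0 // subr_ge0.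
Qed.

Section Counting.
Variables (R : realType) (G : groupType) (I : finType) (gen : I -> G).
Notation wp := (word_prod gen).
Notation coin := (coincidences R gen).

(** Cauchy-Schwarz over the fibres of the code: good words in one fibre coincide in the group. *)
Lemma coincidences_ge n (good : pred (seq I)) (F : finType) (code : seq I -> F) :
  {in words I n &, forall w w', good w -> good w' -> code w = code w' ->
     wp w = wp w'} ->
  (\sum_(w <- words I n) (good w)%:R) ^+ 2 <= #|F|%:R * coin n.
Proof.
move=> inj; pose N k : R := \sum_(w <- words I n) (good w && (code w == k))%:R.
have -> : \sum_(w <- words I n) (good w)%:R = \sum_k N k.
  rewrite exchange_big; apply: eq_bigr => w _ /=.
  rewrite (bigD1 (code w)) //= eqxx andbT big1 ?addr0 // => k.
  by rewrite eq_sym => /negPf ->; rewrite andbF.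
apply: (le_trans (sqr_sum_le N)); rewrite ler_wpM2l //.
have -> : \sum_k N k ^+ 2 = \sum_(w <- words I n) \sum_(w' <- words I n)
    [&& good w, good w' & code w == code w']%:R.
  under eq_bigr => k _.
    rewrite expr2 /N mulr_suml; under eq_bigr => w _ do rewrite mulr_sumr.
    over.
  rewrite exchange_big; apply: eq_bigr => w _ /=.
  rewrite exchange_big; apply: eq_bigr => w' _ /=.
  rewrite (bigD1 (code w)) //= eqxx big1 ?addr0 ?andbT.
    by rewrite -natrM mulnb eq_sym.
  by move=> k; rewrite eq_sym => /negPf ->; rewrite andbF mul0r.
rewrite /coincidences big_seq [leRHS]big_seq; apply: ler_sum => w wn.
rewrite big_seq [leRHS]big_seq; apply: ler_sum => w' wn'.
case: (boolP [&& _, _ & _]) => [/and3P[gw gw' /eqP E]|_]; last by rewrite ler0n.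
by rewrite (inj _ _ wn wn' gw gw' E) eqxx.
Qed.

Lemma expr_le_inv (e : R) n : 0 <= e <= 1 -> (1 - e) ^+ n * (1 + n%:R * e) <= 1.
Proof.
move=> /andP[e0 e1]; elim: n => [|n IH]; first by rewrite expr0; lra.
apply: le_trans IH; rewrite exprS -mulrA mulrCA ler_wpM2l ?exprn_ge0 ?subr_ge0 //.
have n0 : 0 <= n%:R :> R by rewrite ler0n.
rewrite -natr1; nra.
Qed.

Lemma expr_small (e d : R) : 0 < e <= 1 -> 0 < d -> exists n, (1 - e) ^+ n <= d.
Proof.
move=> /andP[e0 e1] d0; pose n := (Num.truncn (d^-1 / e)).+1.
have nP : d^-1 / e < n%:R := truncnS_gt _.
exists n; have := @expr_le_inv e n _; rewrite (ltW e0) e1 => /(_ isT) H.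
have x0 : 0 <= (1 - e) ^+ n by rewrite exprn_ge0 // subr_ge0.
have ne : d^-1 <= 1 + n%:R * e.
  by move: nP; rewrite ltr_pdivrMr // => /ltW; lra.
have : (1 - e) ^+ n * d^-1 <= 1 by apply: le_trans H; rewrite ler_wpM2l.
by rewrite ler_pdivrMr // mul1r.
Qed.

(** Otherwise [coin n] is at most [(1 - eps) ^+ n] times [#|I| ^ (2 n)]. As [C] is independent of
    [q], some [q] has [C * (1 - eps) ^+ q <= 1 / 2], and a large [l] contradicts the hypothesis. *)
Lemma coincidences_ratio (s0 : I) (C : nat) :
  (forall q, exists C0 : nat, forall l,
     (#|I|%:R ^+ (q * l)) ^+ 2 <= C0%:R * C%:R ^+ l * coin (q * l)) ->
  forall eps : R, 0 < eps -> exists n,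
     (1 - eps) * #|I|%:R ^+ 2 * coin n <= coin n.+1.
Proof.
move=> H eps e0; have [e1|e1] := leP 1 eps.
  exists 0%N; apply: (@le_trans _ _ 0); last exact/ltW/coincidences_gt0.
  apply: mulr_le0_ge0; last exact/ltW/coincidences_gt0.
  by apply: mulr_le0_ge0; rewrite ?subr_le0 ?exprn_ge0.
apply: contrapT => nex.
have step n : coin n.+1 <= (1 - eps) * #|I|%:R ^+ 2 * coin n.
  by apply: ltW; rewrite ltNge; apply/negP => h; apply: nex; exists n.
have up n : coin n <= (1 - eps) ^+ n * (#|I|%:R ^+ n) ^+ 2.
  elim: n => [|n IH].
    by rewrite !expr0 expr1n mulr1 /coincidences /= !big_seq1 eqxx.
  apply: (le_trans (step n)).
  rewrite [(1 - eps) ^+ n.+1]exprS [#|I|%:R ^+ n.+1]exprS exprMn.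
  have -> : (1 - eps) * (1 - eps) ^+ n * (#|I|%:R ^+ 2 * (#|I|%:R ^+ n) ^+ 2) =
    (1 - eps) * #|I|%:R ^+ 2 * ((1 - eps) ^+ n * (#|I|%:R ^+ n) ^+ 2) by ring.
  by rewrite ler_wpM2l // mulr_ge0 ?exprn_ge0 // subr_ge0 ltW.
have [q qP] : exists q, (1 - eps) ^+ q <= (2 * (C%:R + 1))^-1.
  by apply: expr_small; rewrite ?e0 ?(ltW e1) // invr_gt0 mulr_gt0 // ltr_wpDl.
have [C0 C0P] := H q.
have [l lP] : exists l, (1 - 1 / 2 : R) ^+ l <= (C0%:R + 1)^-1.
  by apply: expr_small; [lra | rewrite invr_gt0 // ltr_wpDl].
have k0 : 0 < (#|I|%:R ^+ (q * l)) ^+ 2 :> R.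
  by rewrite !exprn_gt0 // ltr0n; apply/card_gt0P; exists s0.
have : (#|I|%:R ^+ (q * l)) ^+ 2 <= C0%:R * C%:R ^+ l *
    ((1 - eps) ^+ (q * l) * (#|I|%:R ^+ (q * l)) ^+ 2).
  by apply: (le_trans (C0P l)); rewrite ler_wpM2l // mulr_ge0 // exprn_ge0.
rewrite mulrA ler_pMl // exprM -mulrA -exprMn => h.
have C1 : 0 < (C%:R + 1 : R) by rewrite ltr_wpDl.
have : C%:R * (1 - eps) ^+ q <= (1 - 1 / 2 : R).
  apply: (@le_trans _ _ ((C%:R + 1) * (2 * (C%:R + 1))^-1)).
    apply: ler_pM => //; first by rewrite exprn_ge0 // subr_ge0 ltW.
    by rewrite lerDl.
  by rewrite invfM mulrCA mulfV ?gt_eqF //; lra.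
move=> /(lerXn2r l) h2.
have {}h2 : (C%:R * (1 - eps) ^+ q) ^+ l <= (C0%:R + 1)^-1.
  apply: le_trans lP; apply: h2; rewrite nnegrE; last lra.
  by rewrite mulr_ge0 // exprn_ge0 // subr_ge0 ltW.
have C01 : 0 < (C0%:R + 1 : R) by rewrite ltr_wpDl.
have : C0%:R * (C%:R * (1 - eps) ^+ q) ^+ l < 1.
  apply: (@le_lt_trans _ _ (C0%:R / (C0%:R + 1))); first by rewrite ler_wpM2l.
  by rewrite ltr_pdivrMr // mul1r ltrDl.
by rewrite ltNge h.
Qed.

End Counting.

(** * Crossings of a reversible walk *)

Section Crossings.
Variables (R : realType) (V I : finType) (step : I -> V -> V).
Hypothesis stepK : forall s, involutive (step s).
Variables (A B : pred V) (h : V -> R).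
Hypotheses (hA : forall v, A v -> h v = 0) (hB : forall v, B v -> h v = 1).
Hypothesis h01 : forall v, 0 <= h v <= 1.
Hypothesis I0 : (0 < #|I|)%N.

Definition flag (f : bool) (v : V) : bool := B v || (~~ A v && f).

(* The number of times the walk started at [v] reaches [B] when its last visit
   to [A] is more recent than the one to [B]; [f] tells which set was visited
   before the start. *)
Fixpoint upcrossings (f : bool) (v : V) (w : seq I) : nat :=
  if w is s :: w' then
    let v' := step s v in
    ((~~ f && flag f v') + upcrossings (flag f v') v' w')%N
  else 0%N.

Lemma upcrossings_flag f f' v w : (upcrossings f v w <= (upcrossings f' v w).+1)%N.
Proof.
elim: w f f' v => //= s w IH f f' v; have := IH (flag f (step s v)) (flag f' (step s v)).
have := IH false true (step s v); rewrite /flag.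
by case: f; case: f'; case: (B _); case: (A _) => /= H H';
  rewrite ?add0n ?add1n ?ltnS //; apply: leq_trans (leqnSn _).
Qed.

(** The Dirichlet form with every edge counted in both directions, whence the factor 2 in the energy
    bounds [2 * e]. *)
Definition dform (u w : V -> R) : R :=
  \sum_v \sum_s (u v - u (step s v)) * (w v - w (step s v)).

Definition lap (w : V -> R) (v : V) : R := \sum_s (w v - w (step s v)).

Notation k := (#|I|%:R : R).

Lemma sum_step s (F : V -> R) : \sum_v F (step s v) = \sum_v F v.
Proof. by rewrite [RHS](reindex_inj (can_inj (stepK s))). Qed.

Lemma dform_lap u w : dform u w = 2 * \sum_v u v * lap w v.
Proof.
rewrite /dform /lap exchange_big mulr_sumr.
have -> : \sum_v 2 * (u v * \sum_s (w v - w (step s v))) =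
    \sum_s \sum_v 2 * (u v * (w v - w (step s v))).
  by rewrite exchange_big; apply: eq_bigr => v _; rewrite mulr_sumr mulr_sumr.
apply: eq_bigr => s _.
have -> : \sum_v (u v - u (step s v)) * (w v - w (step s v)) =
   \sum_v u v * (w v - w (step s v)) - \sum_v u (step s v) * (w v - w (step s v)).
  by rewrite -sumrB; apply: eq_bigr => v _; rewrite mulrBl.
rewrite -(sum_step s (fun v => u (step s v) * _)) /= -sumrB.
by apply: eq_bigr => v _; rewrite !stepK; ring.
Qed.

Lemma dform_ge0 u : 0 <= dform u u.
Proof. by apply: sumr_ge0 => v _; apply: sumr_ge0 => s _; rewrite -expr2 sqr_ge0. Qed.

Lemma dformC u w : dform u w = dform w u.
Proof. by apply: eq_bigr => v _; apply: eq_bigr => s _; rewrite mulrC. Qed.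

Lemma dformDl u u' w : dform (fun v => u v + u' v) w = dform u w + dform u' w.
Proof.
rewrite /dform -big_split; apply: eq_bigr => v _; rewrite -big_split.
by apply: eq_bigr => s _ /=; ring.
Qed.

Lemma dform_sqr u u' : dform (fun v => u v + u' v) (fun v => u v + u' v) =
  dform u u + 2 * dform u u' + dform u' u'.
Proof.
rewrite dformDl [dform u _]dformC [dform u' _]dformC !dformDl.
by rewrite [dform u' u]dformC; ring.
Qed.

Lemma dform_opp u w : dform u (fun v => - w v) = - dform u w.
Proof.
rewrite /dform -sumrN; apply: eq_bigr => v _; rewrite -sumrN.
by apply: eq_bigr => s _; ring.
Qed.

Lemma dform_le u w : dform u w <= (dform u u + dform w w) / 2.
Proof.
have := dform_ge0 (fun v => u v + - w v).
rewrite dform_sqr !dform_opp [dform (fun v => - w v) w]dformC dform_opp; lra.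
Qed.

(* If [u v] is the probability that the flag is raised given that the walk is at
   [v], then [relax u v] is this probability one step later. *)
Definition relax (u : V -> R) (v : V) : R :=
  if B v then 1 else if A v then 0 else k^-1 * \sum_s u (step s v).

Definition admissible (u : V -> R) : Prop :=
  [/\ forall v, B v -> u v = 1, forall v, ~~ B v -> A v -> u v = 0 &
      forall v, 0 <= u v <= 1].

Lemma k_gt0 : 0 < k. Proof. by rewrite ltr0n. Qed.

Lemma relax_admissible u : admissible u -> admissible (relax u).
Proof.
move=> [uB uA u01]; split=> [v|v|v]; rewrite /relax.
- by move=> ->.
- by move=> /negPf -> ->.
case: (B v); first by rewrite ler01 lexx.
case: (A v); first by rewrite ler01 lexx.
rewrite mulr_ge0 ?invr_ge0 ?(ltW k_gt0) //=; last first.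
  by apply: sumr_ge0 => s _; case/andP: (u01 (step s v)).
rewrite mulrC ler_pdivrMr ?k_gt0 // mul1r -sum1_card natr_sum.
by apply: ler_sum => s _; case/andP: (u01 (step s v)).
Qed.

Lemma relax_lap u v : ~~ B v -> ~~ A v -> lap u v = k * (u v - relax u v).
Proof.
move=> /negPf nB /negPf nA; rewrite /lap /relax nB nA sumrB sumr_const mulrBr.
by rewrite mulrA mulfV ?mul1r ?gt_eqF ?k_gt0 // mulr_natl.
Qed.

Lemma relax_id u v : admissible u -> B v || A v -> relax u v = u v.
Proof.
move=> [uB uA _]; rewrite /relax; case: (boolP (B v)) => [/uB -> //|nB /= Av].
by rewrite Av uA.
Qed.

(** The increment [d] vanishes on [A] and [B]. Summation by parts makes the cross term [- 4 * k]
    times the sum of [d ^+ 2], which outweighs [dform d d]. *)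
Lemma relax_dform u : admissible u -> dform (relax u) (relax u) <= dform u u.
Proof.
move=> ua; pose d v := relax u v - u v.
have E : dform (relax u) (relax u) = dform (fun v => u v + d v) (fun v => u v + d v).
  by apply: eq_bigr => v _; apply: eq_bigr => s _; rewrite /d; congr (_ * _); ring.
rewrite E dform_sqr [dform u d]dformC (dform_lap d u).
have -> : \sum_v d v * lap u v = - (k * \sum_v d v ^+ 2).
  rewrite mulr_sumr -sumrN; apply: eq_bigr => v _.
  have [BA|] := boolP (B v || A v); first by rewrite /d relax_id // subrr; ring.
  by rewrite negb_or => /andP[nB nA]; rewrite relax_lap // /d; ring.
suff : dform d d <= 4 * (k * \sum_v d v ^+ 2) by lra.
rewrite /dform exchange_big /=.
apply: (@le_trans _ _ (\sum_(s : I) \sum_v (2 * d v ^+ 2 + 2 * d (step s v) ^+ 2))).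
  apply: ler_sum => s _; apply: ler_sum => v _.
  by have := sqr_ge0 (d v + d (step s v)); nra.
have -> : \sum_(s : I) \sum_v (2 * d v ^+ 2 + 2 * d (step s v) ^+ 2) =
    \sum_(s : I) 4 * \sum_v d v ^+ 2.
  apply: eq_bigr => s _; rewrite big_split /= (sum_step s (fun v => 2 * d v ^+ 2)).
  by rewrite -mulr_sumr; ring.
by rewrite sumr_const -mulr_natl; lra.
Qed.

(** The unnormalized expected number of new upcrossings in one step: an arrival at [v] comes from
    some [step s v], where the flag is down with probability [1 - u]. *)
Definition flux (u : V -> R) : R := \sum_(v | B v) \sum_s (1 - u (step s v)).

(** In the sum of [h v * lap u v], the part on [B] is the flux, the part on [A] outside [B]
    vanishes, and elsewhere [lap u] is [k * (u - relax u)]. The whole is half of [dform h u], at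
    most [e]. *)
Lemma flux_le u e : admissible u -> dform u u <= 2 * e -> dform h h <= 2 * e ->
  flux u <= e - k * (\sum_v h v * u v - \sum_v h v * relax u v).
Proof.
move=> ua ue he; have [uB uA u01] := ua.
have -> : flux u = \sum_v h v * lap u v -
    k * (\sum_v h v * u v - \sum_v h v * relax u v).
  rewrite -sumrB mulr_sumr -sumrB /flux big_mkcond; apply: eq_bigr => v _.
  case: ifPn => [Bv|nB].
    by rewrite relax_id ?Bv // subrr mulr0 subr0 hB // mul1r /lap uB.
  have [Av|nA] := boolP (A v); first by rewrite hA //; ring.
  by rewrite relax_lap //; ring.
have := dform_le h u; rewrite dform_lap => H.
by rewrite lerD2r; lra.
Qed.

Definition mean_up (u : V -> R) (m : nat) : R :=
  \sum_v \sum_(w <- words I m)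
    (u v * (upcrossings true v w)%:R + (1 - u v) * (upcrossings false v w)%:R).

Lemma sum_cst (c : R) : \sum_(s : I) c = k * c.
Proof. by rewrite sumr_const mulr_natl. Qed.

(** Reindexing by [step s] reverses the first step: the uniform start is stationary, and after the
    step the flag is raised with probability [relax u]. *)
Lemma mean_upS u m : admissible u ->
  mean_up u m.+1 = k * mean_up (relax u) m + k ^+ m * flux u.
Proof.
move=> ua; have [uB uA u01] := ua; rewrite /mean_up.
under eq_bigr => v _ do rewrite sum_wordsS.
rewrite exchange_big /=.
have -> : \sum_(s : I) \sum_v \sum_(w <- words I m)
   (u v * (upcrossings true v (s :: w))%:R + (1 - u v) * (upcrossings false v (s :: w))%:R)
  = \sum_v \sum_(w <- words I m) \sum_(s : I)
     (u (step s v) * (upcrossings (flag true v) v w)%:R +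
      (1 - u (step s v)) * (flag false v + upcrossings (flag false v) v w)%:R).
  rewrite [RHS](eq_bigr (fun v => \sum_(s : I) \sum_(w <- words I m)
     (u (step s v) * (upcrossings (flag true v) v w)%:R +
      (1 - u (step s v)) * (flag false v + upcrossings (flag false v) v w)%:R))).
    rewrite [RHS]exchange_big; apply: eq_bigr => s _ /=.
    rewrite -(sum_step s); apply: eq_bigr => v _; apply: eq_bigr => w _.
    by rewrite /= !stepK add0n.
  by move=> v _; rewrite exchange_big.
rewrite mulr_sumr /flux [X in k ^+ m * X]big_mkcond mulr_sumr -big_split /=.
apply: eq_bigr => v _; rewrite mulr_sumr.
have -> : k ^+ m * (if B v then \sum_s (1 - u (step s v)) else 0) =
   \sum_(w <- words I m) (if B v then \sum_s (1 - u (step s v)) else 0).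
  by rewrite big_const_seq count_predT size_words iter_addr_0 -[RHS]mulr_natl natrX.
rewrite -big_split /=; apply: eq_bigr => w _; rewrite /relax /flag.
case: (B v) => /=.
  rewrite (eq_bigr (fun s => (upcrossings true v w)%:R + (1 - u (step s v)))).
    by rewrite big_split /= sum_cst; ring.
  by move=> s _; rewrite natrD; ring.
case: (A v) => /=.
  rewrite (eq_bigr (fun=> (upcrossings false v w)%:R)).
    by rewrite sum_cst; ring.
  by move=> s _; rewrite add0n; ring.
under eq_bigr => s _ do rewrite add0n.
rewrite big_split /= -!mulr_suml sumrB sum_cst mulr1.
have kV : k * k^-1 = 1 by rewrite mulfV // gt_eqF // k_gt0.
set S := \sum_s _; set x := (_)%:R; set y := (upcrossings false v w)%:R.
have -> : k * (k^-1 * S * x + (1 - k^-1 * S) * y) + 0 =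
  (k * k^-1) * (S * x) + (k - (k * k^-1) * S) * y by ring.
by rewrite kV; ring.
Qed.

(* The pairing of [h] with [u] serves as a potential: by [flux_le] it pays for
   the part of the flux that is not accounted for by the energy, which does not
   increase under [relax]. *)
Lemma mean_up_le u e m : admissible u -> dform u u <= 2 * e -> dform h h <= 2 * e ->
  k * mean_up u m <= k ^+ m * (m%:R * e + k * (#|V|%:R - \sum_v h v * u v)).
Proof.
elim: m u => [|m IH] u ua ue he.
  rewrite /mean_up big1 ?mulr0; last first.
    by move=> v _; rewrite /= big_seq1 /= !mulr0 addr0.
  rewrite expr0 mul1r mul0r add0r mulr_ge0 ?(ltW k_gt0) // subr_ge0.
  rewrite -sum1_card natr_sum; apply: ler_sum => v _; have [_ _ u01] := ua.
  by have /andP[? ?] := u01 v; have /andP[? ?] := h01 v; nra.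
rewrite mean_upS // mulrDr exprS.
have := IH _ (relax_admissible ua) (le_trans (relax_dform ua) ue) he.
rewrite -(ler_pM2l k_gt0) => H1.
have := flux_le ua ue he; rewrite -(ler_pM2l (exprn_gt0 m k_gt0)).
rewrite -(ler_pM2l k_gt0) => H2.
apply: (le_trans (lerD H1 H2)); rewrite -natr1.
by rewrite le_eqVlt; apply/orP; left; apply/eqP; ring.
Qed.

(** Start with the flag distributed according to [h]; a fixed initial flag changes each count by at
    most one, which costs a second [k * #|V|]. *)
Lemma upcrossings_le f m : admissible h ->
  k * \sum_v \sum_(w <- words I m) (upcrossings f v w)%:R <=
  k ^+ m * (m%:R * (dform h h / 2) + 2 * k * #|V|%:R).
Proof.
move=> ha; have H := @mean_up_le h (dform h h / 2) m ha.
have {}H : k * mean_up h m <= k ^+ m * (m%:R * (dform h h / 2) + k * #|V|%:R).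
  apply: le_trans (H _ _) _; try lra.
  rewrite ler_wpM2l ?exprn_ge0 // lerD2l ler_wpM2l // gerBl.
  by apply: sumr_ge0 => v _; have /andP[? ?] := h01 v; rewrite mulr_ge0.
have : \sum_v \sum_(w <- words I m) (upcrossings f v w)%:R <=
    mean_up h m + k ^+ m * #|V|%:R.
  have -> : k ^+ m * #|V|%:R = \sum_(v : V) \sum_(w <- words I m) (1 : R).
    rewrite exchange_big /= big_const_seq count_predT size_words iter_addr_0.
    by rewrite sumr_const -[RHS]mulr_natl natrX.
  rewrite /mean_up -big_split; apply: ler_sum => v _; rewrite -big_split.
  apply: ler_sum => w _ /=; have /andP[? ?] := h01 v.
  have := upcrossings_flag f true v w; rewrite -(ler_nat R) -natr1 => ?.
  have := upcrossings_flag f false v w; rewrite -(ler_nat R) -natr1 => ?.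
  by nra.
rewrite -(ler_pM2l k_gt0) => /le_trans; apply.
rewrite mulrDr; apply: le_trans (lerD H (lexx _)) _.
by rewrite le_eqVlt; apply/orP; left; apply/eqP; ring.
Qed.

End Crossings.

(** The sections are trivial or [w] itself, so triviality follows by induction on the word acted
    on. *)
Lemma ev_fix w :
  all (fun x => (run w x).1 == x) letters ->
  all (fun x => ((run w x).2 == [::]) || ((run w x).2 == w)) letters -> ev w = 1%g.
Proof.
move=> /letters_all H1 /letters_all H2; apply: act_ext; elim=> [|x u IH].
  exact: act_nil.
rewrite act_run (eqP (H1 x)) act1; congr (_ :: _).
by case/orP: (H2 x) => /eqP ->.
Qed.

(** * The walk on the carpet graphs *)

Section Coordinate.
Variables e0 e1 : 'I_4.
Hypothesis eP : (e0, e1) \in [:: (gc, ga); (gb, gd)].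

Definition letter_coord (x : X) : nat :=
  if side e0 x then 0 else if side e1 x then 2 else 1.

(* The first letter is the finest scale, and adjacent tiles are mirror images of
   each other, hence the parity. *)
Fixpoint coord (v : seq X) : nat :=
  if v is x :: v' then
    (3 * coord v' +
     if odd (coord v') then 2 - letter_coord x else letter_coord x)%N
  else 0%N.

Lemma letter_coord_le2 x : (letter_coord x <= 2)%N.
Proof. by rewrite /letter_coord; case: ifP => //; case: ifP. Qed.

Lemma coord_lt v : (coord v < 3 ^ size v)%N.
Proof.
clear eP; elim: v => //= x v IH; have := letter_coord_le2 x; rewrite expnS.
by case: (odd _); lia.
Qed.

Lemma coord_side0 v : all (side e0) v -> coord v = 0%N.
Proof. by elim: v => //= x v IH /andP[xe /IH ->]; rewrite /letter_coord xe. Qed.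

Lemma side_disjoint x : side e1 x -> side e0 x = false.
Proof.
move=> xe; apply/negbTE; move: xe; apply/implyP; move: x; apply: letters_all.
by move: eP; rewrite !inE => /orP[] /eqP[-> ->]; vm_compute.
Qed.

Lemma coord_side1 v : all (side e1) v -> (coord v).+1 = (3 ^ size v)%N.
Proof.
elim: v => //= x v IH /andP[xe /IH E].
have -> : odd (coord v) = false.
  by have := oddX 3 (size v); rewrite -E /= orbT => /negbTE.
by rewrite /letter_coord xe side_disjoint // expnS -E; lia.
Qed.

Lemma letter_coord_gperm s x : ~~ side s x ->
  letter_coord (gperm s x) = letter_coord x \/
  (s = e1 /\ letter_coord x + letter_coord (gperm s x) = 1)%N \/
  (s = e0 /\ letter_coord x + letter_coord (gperm s x) = 3)%N.
Proof.
move=> xs; suff : [|| letter_coord (gperm s x) == letter_coord x,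
    (s == e1) && (letter_coord x + letter_coord (gperm s x) == 1)%N |
    (s == e0) && (letter_coord x + letter_coord (gperm s x) == 3)%N].
  case/or3P => [/eqP|/andP[/eqP -> /eqP]|/andP[/eqP -> /eqP]]; first by left.
    by right; left.
  by right; right.
move: xs; apply/implyP; move: x; apply: letters_all; move: s; apply: gens_all.
by rewrite /letter_coord; move: eP; rewrite !inE => /orP[] /eqP[-> ->]; vm_compute.
Qed.

(** When the coordinate moves, [e1] exchanges [2 j] and [2 j + 1], and [e0] exchanges [2 j + 1] and
    [2 j + 2]. The parities make the induction on [v] go through. *)
Lemma coord_gen s v : let k := coord v in let k' := coord (act (gen s) v) in
  k' = k \/
  (s = e1 /\ if odd k then k'.+1 = k else k' = k.+1) \/
  (s = e0 /\ if odd k then k' = k.+1 else k'.+1 = k).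
Proof.
elim: v => [|x v /= IH] /=; first by rewrite gen_act0; left.
rewrite gen_act; case: ifPn => [xs|xs] /=; last first.
  have := letter_coord_le2 x; have := letter_coord_le2 (gperm s x).
  move: (coord v) => k; case: (letter_coord_gperm xs) => [->|]; first by left.
  move: (letter_coord x) (letter_coord (gperm s x)) => c c' cc' h1 h2; right.
  by case: cc' => -[E H]; [left|right]; split=> //; rewrite oddD oddM;
    case: (odd k) => /=; case: c H h2 => [|[|[|c]]] //= H h2; lia.
rewrite side_gperm //; case: IH => [->|IH]; first by left.
right; have oddE : odd (coord (act (gen s) v)) = ~~ odd (coord v).
  case: IH => -[_]; case: ifP => o H; rewrite ?H /= ?o //.
    by move: o; rewrite -H /= => /negbTE.
  by move: o; rewrite -H /= => /negbFE.
move: oddE IH; move: (coord v) (coord _) => k k' oddE.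
case=> -[E H]; [left|right]; split=> //.
  have -> : letter_coord x = 2%N by rewrite /letter_coord -E xs side_disjoint // -E.
  by rewrite oddE oddD oddM; move: H; case: (odd k) => /= H; lia.
have -> : letter_coord x = 0%N by rewrite /letter_coord -E xs.
by rewrite oddE oddD oddM; move: H; case: (odd k) => /= H; lia.
Qed.

Lemma coord_gen_dist s v :
  (coord (act (gen s) v) <= (coord v).+1)%N /\ (coord v <= (coord (act (gen s) v)).+1)%N.
Proof.
have /= := coord_gen s v.
by case=> [->|[[_]|[_]]]; first lia; case: (odd _); lia.
Qed.

End Coordinate.

Definition gprod (l : seq G) : G := foldr mul 1%g l.

Lemma gprod_rcons l g : gprod (rcons l g) = (gprod l * g)%g.
Proof.
by elim: l => [|h l IH] /=; rewrite ?mulg1 ?mul1g // IH mulgA.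
Qed.

Definition lazy_gen (s : option 'I_4) : G := oapp gen 1%g s.

Lemma lazy_gen_ind (P : G -> Prop) : P 1%g ->
  (forall s g, P g -> P (lazy_gen s * g)%g) -> forall g, P g.
Proof. by move=> P1 PS; apply: gen_ind => // s g; apply: (PS (Some s)). Qed.

Definition vstep n (s : option 'I_4) (v : n.-tuple X) : n.-tuple X :=
  if s is Some s then tcast (etrans (size_act (gen s) v) (size_tuple v))
                            (in_tuple (act (gen s) v))
  else v.

Lemma val_vstep n s (v : n.-tuple X) : vstep s v = act (lazy_gen s) v :> seq X.
Proof. by case: s => [s|] /=; rewrite ?val_tcast. Qed.

Lemma vstepK n s : involutive (@vstep n s).
Proof.
move=> v; apply: val_inj; rewrite /= !val_vstep.
by case: s => [s|] //=; rewrite ?genK ?act1.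
Qed.

Definition emit (s : option 'I_4) (v : seq X) : option 'I_4 :=
  if s is Some t then (if all (side t) v then s else None) else None.

Lemma act_emit s v u :
  act (lazy_gen s) (v ++ u) = act (lazy_gen s) v ++ act (lazy_gen (emit s v)) u.
Proof.
case: s => [s|] /=; last by rewrite !act1.
case: ifPn => [vs|vs] /=.
  by rewrite gen_act_side // -{2}[v]cats0 gen_act_side // gen_act0 cats0.
by rewrite act1 gen_act_not_side.
Qed.

Lemma emit_vstep n s (v : n.-tuple X) t : emit s v = Some t ->
  vstep s v = v /\ all (side t) v.
Proof.
case: s => [s|] //=; case: ifP => // vs [<-]; split=> //.
apply: val_inj; rewrite /= val_tcast /=.
by rewrite -{1}[tval v]cats0 gen_act_side // gen_act0 cats0.
Qed.

Lemma top_gt0 (R : realType) n : (0 < n)%N -> 0 < (3 ^ n).-1%:R :> R.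
Proof.
by case: n => // n _; rewrite ltr0n expnS; have := expn_gt0 3 n; lia.
Qed.

Section Height.
Variables (R : realType) (n : nat) (e0 e1 : 'I_4).
Hypothesis eP : (e0, e1) \in [:: (gc, ga); (gb, gd)].
Hypothesis n0 : (0 < n)%N.

Definition low (v : n.-tuple X) : bool := all (side e0) v.
Definition high (v : n.-tuple X) : bool := all (side e1) v.

Definition height (v : n.-tuple X) : R := (coord e0 e1 v)%:R / (3 ^ n).-1%:R.

Lemma height_low v : low v -> height v = 0.
Proof. by move=> lv; rewrite /height coord_side0 // mul0r. Qed.

Lemma height_high v : high v -> height v = 1.
Proof.
move=> hv; have := coord_side1 eP hv; rewrite size_tuple => E.
have {}E : coord e0 e1 v = (3 ^ n).-1 by rewrite -E.
by rewrite /height E mulfV // gt_eqF // top_gt0.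
Qed.

Lemma height01 v : 0 <= height v <= 1.
Proof.
rewrite divr_ge0 //= ler_pdivrMr ?top_gt0 // mul1r ler_nat.
by have := coord_lt e0 e1 v; rewrite size_tuple; lia.
Qed.

Lemma low_high v : high v -> low v = false.
Proof.
rewrite /low /high; case: v => -[|x v] /=; first by case: n n0.
by move=> _ /andP[xe _]; rewrite (side_disjoint eP).
Qed.

Lemma height_admissible : admissible low high height.
Proof.
split=> [v|v _|v]; [exact: height_high|exact: height_low|exact: height01].
Qed.

Lemma height_dform :
  dform (@vstep n) height height <= 5 * 8 ^+ n / (3 ^ n).-1%:R ^+ 2.
Proof.
have step v s : (height v - height (vstep s v)) * (height v - height (vstep s v)) <=
    ((3 ^ n).-1%:R ^+ 2)^-1.
  rewrite /height -mulrBl -expr2 exprMn exprVn -[leRHS]mul1r.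
  rewrite ler_wpM2r ?invr_ge0 ?exprn_ge0 // -[leRHS](expr1n _ 2%N).
  rewrite -real_normK ?num_real // lerXn2r ?nnegrE //.
  rewrite val_vstep; case: s => [s|] /=; last by rewrite subrr normr0.
  have [h1 h2] := coord_gen_dist eP s v.
  rewrite ler_norml; apply/andP; split.
    by rewrite lerBDr addrC -lerBDr opprK natr1 ler_nat.
  by rewrite lerBlDr addrC natr1 ler_nat.
apply: (@le_trans _ _ (\sum_(v : n.-tuple X) \sum_(s : option 'I_4)
    ((3 ^ n).-1%:R ^+ 2)^-1)).
  by apply: ler_sum => v _; apply: ler_sum => s _.
rewrite !sumr_const card_option card_tuple !card_ord.
by rewrite -[leLHS]mulr_natl -[X in _ * X]mulr_natl natrX mulrA [_ * 5]mulrC.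
Qed.

Lemma flag_low f v : low v -> flag low high f v = false.
Proof.
move=> lv; rewrite /flag lv orbF; apply/negbTE/negP => hv.
by rewrite low_high in lv.
Qed.

Lemma flag_high f v : high v -> flag low high f v = true.
Proof. by rewrite /flag => ->. Qed.

End Height.

(** * Sections as products of elements of finite dihedral groups *)

Section Dihedral.
Local Open Scope group_scope.
Variables s t : 'I_4.
Hypothesis st : (s, t) \in [:: (gc, gb); (gc, gd); (ga, gb); (ga, gd)].

Definition dihedral : seq G :=
  [seq (gen s * gen t) ^+ i * gen s ^+ j | i <- iota 0 6, j <- iota 0 2].

Lemma gen_sqr r : gen r * gen r = 1.
Proof. by rewrite -{1}genV mulVg. Qed.

Lemma dihedral_exp6 : (gen s * gen t) ^+ 6 = 1.
Proof.
have -> : (gen s * gen t) ^+ 6 = ev (flatten (nseq 6 [:: s; t])).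
  by rewrite /= mulg1 !expgS expg0 mulg1 !mulgA.
move: st; rewrite !inE => /or4P[] /eqP[-> ->]; apply: ev_fix; by vm_compute.
Qed.

Lemma dihedral_mem i (j : bool) :
  (gen s * gen t) ^+ i * gen s ^+ j \in dihedral.
Proof.
apply/allpairsP; exists ((i %% 6)%N, nat_of_bool j); split.
- by change (i %% 6 \in iota 0 6)%N; rewrite mem_iota ltn_mod.
- by case: j.
rewrite /= {1}(divn_eq i 6) mulnC expgnDr expgnA dihedral_exp6 expg1n mul1g.
by [].
Qed.

Lemma dihedral1 : 1 \in dihedral.
Proof. by have := dihedral_mem 0 false; rewrite !expg0 mulg1. Qed.

Lemma dihedralM g r : g \in dihedral -> r \in [:: s; t] -> g * gen r \in dihedral.
Proof.
move=> /allpairsP [[i j] /= [_ j2 ->]].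
have {j2} [b ->] : exists b : bool, j = b.
  by move: j2; rewrite !inE => /orP[] /eqP ->; [exists false|exists true].
rewrite mem_seq2 => /orP[] /eqP ->; rewrite -mulgA.
  case: b; rewrite /= ?expg1 ?expg0 ?mul1g.
    by rewrite gen_sqr; apply: (dihedral_mem i false).
  exact: (dihedral_mem i true).
case: b; rewrite /= ?expg1 ?expg0 ?mul1g.
  by rewrite -expgSr -[X in X \in _]mulg1; apply: (dihedral_mem i.+1 false).
(* Without a trailing [s], multiplication by [t] uses [t = (s t) ^ 5 s]. *)
have := dihedral_mem (i + 5) true; rewrite expg1 expgnDr -mulgA.
suff -> : (gen s * gen t) ^+ 5 * gen s = gen t by [].
apply: (mulgI (gen s * gen t)); rewrite mulgA -expgS dihedral_exp6 mul1g.
by rewrite -mulgA gen_sqr mulg1.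
Qed.
End Dihedral.

(** The horizontal letter compatible with flag [f]: the other one is emitted only on its own side,
    where the flag is switched. *)
Definition hletter (f : bool) := if f then ga else gc.
Definition vletter (f : bool) := if f then gd else gb.

Definition block_group (fh fv : bool) : seq G := dihedral (hletter fh) (vletter fv).

Lemma block_letters fh fv : (hletter fh, vletter fv) \in
  [:: (gc, gb); (gc, gd); (ga, gb); (ga, gd)].
Proof. by case: fh; case: fv. Qed.

Definition blocks : seq G :=
  flatten [seq block_group f.1 f.2 | f <- [:: (true, true); (true, false);
                                             (false, true); (false, false)]].

Lemma block_group_sub fh fv : {subset block_group fh fv <= blocks}.
Proof.
move=> g gb; apply/flattenP; exists (block_group fh fv) => //.
by apply/mapP; exists (fh, fv); rewrite //; case: fh {gb}; case: fv.
Qed.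

Section Sections.
Variable n : nat.
Hypothesis n0 : (0 < n)%N.

Notation hflag := (flag (@low n gc) (@high n ga)).
Notation vflag := (flag (@low n gb) (@high n gd)).
Notation hup := (upcrossings (@vstep n) (@low n gc) (@high n ga)).
Notation vup := (upcrossings (@vstep n) (@low n gb) (@high n gd)).

(** The inverse of [word_prod w] applies the letters of [w] from left to right, as the walk does;
    hence sections of inverses are tracked. *)
Definition endpoint (w : seq (option 'I_4)) (v : n.-tuple X) : n.-tuple X :=
  foldl (fun v s => vstep s v) v w.

(** Raising and lowering alternate, so twice the upcrossings plus [f] drops by one exactly when the
    flag changes; it bounds the number of blocks. *)
Lemma flag_count (T : finType) (st : option 'I_4 -> T -> T) (A B : pred T) f v s w :
  (2 * upcrossings st A B f v (s :: w) + f =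
   2 * upcrossings st A B (flag A B f (st s v)) (st s v) w +
     flag A B f (st s v) + (f != flag A B f (st s v)))%N.
Proof. by rewrite /=; case: f; case: (flag A B _ _) => /=; lia. Qed.

(* Between two changes of the flags, the letters emitted by the walk at a
   vertex all lie in one finite dihedral group. *)
Lemma section_blocks w fh fv v : exists l d,
  [/\ {subset l <= blocks}, d \in block_group fh fv,
      (size l <= 2 * hup fh v w + fh + (2 * vup fv v w + fv))%N &
      forall u, act (word_prod lazy_gen w)^-1%g (v ++ u) =
        endpoint w v ++ act (gprod l * d)%g u].
Proof.
elim: w fh fv v => [|s w IH] fh fv v.
  exists [::], 1%g; split=> //; first exact: dihedral1 (block_letters _ _).
  by move=> u; rewrite /= invg1 mulg1 !act1.
have [l [d [lP dP lS lE]]] := IH (hflag fh (vstep s v)) (vflag fv (vstep s v)) (vstep s v).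
pose d' := (d * lazy_gen (emit s v))%g.
have d'P : d' \in block_group (hflag fh (vstep s v)) (vflag fv (vstep s v)).
  rewrite /d'; case Es: (emit s v) => [t|]; last by rewrite mulg1.
  have [vE tv] := emit_vstep Es; apply: dihedralM => //; rewrite vE in dP *.
    exact: block_letters.
  rewrite !inE.
  have : t \in genlist := mem_genlist t.
  rewrite !inE => /or4P[] /eqP tE; rewrite tE in tv.
  - by rewrite flag_high // tE.
  - by rewrite [vflag _ _]flag_low // tE ?orbT.
  - by rewrite [hflag _ _]flag_low // tE.
  - by rewrite [vflag _ _]flag_high // tE orbT.
have E u : act (word_prod lazy_gen (s :: w))^-1%g (v ++ u) =
    endpoint (s :: w) v ++ act (gprod l * d')%g u.
  rewrite /= invMg [LHS]actM.
  have -> : ((lazy_gen s)^-1 = lazy_gen s)%g.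
    by case: s {lE lS dP d' d'P} => [s|] /=; rewrite ?genV ?invg1.
  by rewrite act_emit -val_vstep lE /d' mulgA actM.
have := flag_count (@vstep n) (@low n gc) (@high n ga) fh v s w.
have := flag_count (@vstep n) (@low n gb) (@high n gd) fv v s w.
move=> Ev Eh; rewrite Ev Eh.
have [/andP[/eqP hh /eqP vv]|ne] := boolP
    ((fh == hflag fh (vstep s v)) && (fv == vflag fv (vstep s v))); last first.
  (* A flag changes at this step: [d'] becomes a full block and the preceding block starts as the
     identity. *)
  exists (rcons l d'), 1%g; split.
  - move=> g; rewrite mem_rcons inE => /orP[/eqP ->|/lP //].
    exact: block_group_sub d'P.
  - exact: dihedral1 (block_letters _ _).
  - by rewrite size_rcons; move: ne lS; rewrite negb_and => /orP[] -> /=; lia.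
  - by move=> u; rewrite E mulg1 gprod_rcons.
exists l, d'; split=> //; first by rewrite hh vv.
by rewrite -hh -vv !eqxx !addn0; move: lS; rewrite -hh -vv.
Qed.

End Sections.

(** * Coding words of the walk by their blocks *)

Notation block := (seq_sub blocks).

Definition encode (l : seq G) : seq (option block) := map insub l.

(* [None] separates the blocks of consecutive vertices. *)
Fixpoint decode (c : seq (option block)) (i : nat) : G :=
  match c, i with
  | [::], _ => 1%g
  | None :: c', 0%N => 1%g
  | None :: c', i'.+1 => decode c' i'
  | Some e :: c', 0%N => (ssval e * decode c' 0)%g
  | Some _ :: c', i'.+1 => decode c' i
  end.

Lemma decode_encode l r i : {subset l <= blocks} ->
  decode (encode l ++ None :: r) i = if i is i'.+1 then decode r i' else gprod l.
Proof.
elim: l => [|g l IH] sub; first by case: i.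
have gb : g \in blocks by apply: sub; rewrite inE eqxx.
have {}IH : decode (encode l ++ None :: r) i =
    if i is i'.+1 then decode r i' else gprod l.
  by apply: IH => h hl; apply: sub; rewrite inE hl orbT.
by rewrite /= insubT /=; case: i IH => [|i] ->.
Qed.

Definition flat_code (ls : seq (seq G)) : seq (option block) :=
  flatten [seq rcons (encode l) None | l <- ls].

Lemma decode_flat (ls : seq (seq G)) r i : {in ls, forall l, {subset l <= blocks}} ->
  (i < size ls)%N -> decode (flat_code ls ++ r) i = gprod (nth [::] ls i).
Proof.
elim: ls i => // l ls IH i sub il.
rewrite /flat_code /= -cats1 -!catA /= decode_encode; last first.
  by apply: sub; rewrite inE eqxx.
case: i il => [|i] //= il; apply: IH => // l' l'ls.
by apply: sub; rewrite inE l'ls orbT.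
Qed.

Lemma size_flat_code ls :
  size (flat_code ls) = (\sum_(l <- ls) (size l).+1)%N.
Proof.
rewrite /flat_code size_flatten /shape -map_comp sumnE big_map.
by apply: eq_bigr => l _; rewrite /= size_rcons size_map.
Qed.

Lemma decode_mkseq (ls : seq (seq G)) K i : {in ls, forall l, {subset l <= blocks}} ->
  (i < size ls)%N -> (size (flat_code ls) <= K)%N ->
  decode (mkseq (nth None (flat_code ls)) K) i = gprod (nth [::] ls i).
Proof.
move=> sub il szK; rewrite -(subnKC szK) /mkseq iotaD map_cat.
have -> : [seq nth None (flat_code ls) j | j <- iota 0 (size (flat_code ls))] =
    flat_code ls by exact: mkseq_nth.
exact: decode_flat.
Qed.

Section Code.
Variables (n : nat).
Hypothesis n0 : (0 < n)%N.

Notation V := (n.-tuple X).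
Notation hup := (upcrossings (@vstep n) (@low n gc) (@high n ga) false).
Notation vup := (upcrossings (@vstep n) (@low n gb) (@high n gd) false).

Lemma section_blocks_ex (w : seq (option 'I_4)) (v : V) : exists l,
  [/\ {subset l <= blocks}, (size l <= (2 * (hup v w + vup v w)).+1)%N &
      forall u, act (word_prod lazy_gen w)^-1%g (v ++ u) =
        endpoint w v ++ act (gprod l) u].
Proof.
have [l [d [lP dP lS lE]]] := section_blocks n0 w false false v.
exists (rcons l d); split.
- move=> g; rewrite mem_rcons inE => /orP[/eqP ->|/lP //].
  exact: block_group_sub dP.
- by move: lS; rewrite size_rcons; lia.
- by move=> u; rewrite lE gprod_rcons.
Qed.

Definition section_list w v : seq G := projT1 (cid (section_blocks_ex w v)).

Lemma section_listP w v : [/\ {subset section_list w v <= blocks},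
  (size (section_list w v) <= (2 * (hup v w + vup v w)).+1)%N &
      forall u, act (word_prod lazy_gen w)^-1%g (v ++ u) =
        endpoint w v ++ act (gprod (section_list w v)) u].
Proof. by rewrite /section_list; case: cid. Qed.

Definition crossings (w : seq (option 'I_4)) : nat :=
  (\sum_(v : V) (hup v w + vup v w))%N.

Definition word_code K (w : seq (option 'I_4)) :
    {ffun 'I_K -> option block} * {ffun V -> V} :=
  ([ffun i : 'I_K => nth None (flat_code [seq section_list w v | v <- enum {: V}]) i],
   [ffun v => endpoint w v]).

Lemma act_ext_level (g h : G) :
  (forall (v : V) u, act g (v ++ u) = act h (v ++ u)) -> g = h.
Proof.
move=> E; apply: act_ext => u.
have E' : act g (u ++ nseq n (lt8 0)) = act h (u ++ nseq n (lt8 0)).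
  have sz : size (take n (u ++ nseq n (lt8 0))) == n.
    by rewrite size_takel // size_cat size_nseq leq_addl.
  by rewrite -(cat_take_drop n (u ++ _)); apply: (E (Tuple sz)).
have [g' Eg] := act_section g u; have [h' Eh] := act_section h u.
move: E'; rewrite Eg Eh => /(congr1 (take (size u))).
by rewrite !take_size_cat ?size_act.
Qed.

Lemma word_code_inj K w w' :
  (2 * crossings w + 2 * #|{: V}| <= K)%N ->
  (2 * crossings w' + 2 * #|{: V}| <= K)%N ->
  word_code K w = word_code K w' -> word_prod lazy_gen w = word_prod lazy_gen w'.
Proof.
move=> Kw Kw' [/ffunP E1 /ffunP E2]; apply: invg_inj; apply: act_ext_level => v u.
have [_ _ ->] := section_listP w v; have [_ _ ->] := section_listP w' v.
have := E2 v; rewrite !ffunE => ->; congr (_ ++ act _ u).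
pose ls w := [seq section_list w v | v <- enum {: V}].
have sub w0 : {in ls w0, forall l, {subset l <= blocks}}.
  by move=> _ /mapP [v0 _ ->]; case: (section_listP w0 v0).
(* Each vertex contributes one extra block and one separator, whence [2 * #|V|]. *)
have sz w0 : (2 * crossings w0 + 2 * #|{: V}| <= K)%N -> (size (flat_code (ls w0)) <= K)%N.
  apply: leq_trans; rewrite size_flat_code big_map big_enum /= /crossings.
  rewrite -sum1_card !big_distrr -big_split; apply: leq_sum => v0 _ /=.
  by have [_ + _] := section_listP w0 v0; rewrite muln1 addn2 ltnS.
have iV w0 : (index v (enum {: V}) < size (ls w0))%N.
  by rewrite size_map index_mem mem_enum.
have nthE w0 : nth [::] (ls w0) (index v (enum {: V})) = section_list w0 v.
  by rewrite (nth_map v) ?index_mem ?mem_enum // nth_index ?mem_enum.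
rewrite -!nthE -(decode_mkseq (sub w) (iV w) (sz w Kw)).
rewrite -(decode_mkseq (sub w') (iV w') (sz w' Kw')).
congr decode; apply: (@eq_from_nth _ None); rewrite !size_mkseq // => i iK.
by have := E1 (Ordinal iK); rewrite !ffunE !nth_mkseq.
Qed.

Variable R : realType.

Definition energy : R := 5 * 8 ^+ n / (3 ^ n).-1%:R ^+ 2.

Lemma sum_crossings m : 5 * \sum_(w <- words (option 'I_4) m) (crossings w)%:R <=
  5 ^+ m * (m%:R * energy + 20 * 8 ^+ n) :> R.
Proof.
have k5 : #|{: option 'I_4}|%:R = 5 :> R by rewrite card_option card_ord.
have V8 : #|{: V}|%:R = 8 ^+ n :> R by rewrite card_tuple card_ord natrX.
have I0 : (0 < #|{: option 'I_4}|)%N by rewrite card_option.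
have one e0 e1 : (e0, e1) \in [:: (gc, ga); (gb, gd)] ->
    5 * \sum_(v : V) \sum_(w <- words (option 'I_4) m)
      (upcrossings (@vstep n) (@low n e0) (@high n e1) false v w)%:R <=
    5 ^+ m * (m%:R * (energy / 2) + 10 * 8 ^+ n) :> R.
  move=> eP; have := upcrossings_le (@vstepK n) (@height_low R n e0 e1 )
    (@height_high R n e0 e1 eP n0) (@height01 R n e0 e1 eP n0) I0 false m
    (height_admissible R eP n0).
  rewrite k5 V8 => /le_trans; apply; rewrite ler_wpM2l ?exprn_ge0 //.
  have -> : 2 * 5 = 10 :> R by ring.
  rewrite lerD2r ler_wpM2l // ler_wpM2r ?invr_ge0 //.
  exact: height_dform.
have := one gc ga isT; have := one gb gd isT => Hv Hh.
have -> : \sum_(w <- words (option 'I_4) m) (crossings w)%:R =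
    \sum_(v : V) \sum_(w <- words (option 'I_4) m) (hup v w)%:R +
    \sum_(v : V) \sum_(w <- words (option 'I_4) m) (vup v w)%:R :> R.
  rewrite [X in _ = X + _]exchange_big [X in _ = _ + X]exchange_big -big_split.
  apply: eq_bigr => w _ /=; rewrite -big_split natr_sum; apply: eq_bigr => v _ /=.
  by rewrite natrD.
rewrite mulrDr; apply: le_trans (lerD Hh Hv) _.
by rewrite le_eqVlt; apply/orP; left; apply/eqP; field.
Qed.

Lemma coincidences_lower q l : q%:R * energy <= 1 :> R ->
  (5 ^+ (q * l)) ^+ 2 <=
    4 * (#|{: option block}|%:R ^+ (18 * 8 ^ n) * #|{: {ffun V -> V}}|%:R) *
    (#|{: option block}|%:R ^+ 2) ^+ l * coincidences R lazy_gen (q * l).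
Proof.
move=> qe; set m := (q * l)%N.
(* By [sum_crossings] the mean number of crossings is at most [(l + 20 * 8 ^ n) / 5], below [T / 2].
   By Markov's inequality at least half of the words have at most [T] crossings, and codes of length
   [K] suffice for these. *)
pose T := (l + 8 * 8 ^ n)%N; pose K := (2 * T + 2 * #|{: V}|)%N.
pose good w := (crossings w <= T)%N.
have := @coincidences_ge R _ _ lazy_gen m good _ (word_code K) _.
have inj : {in words (option 'I_4) m &, forall w w' : seq (option 'I_4),
    good w -> good w' -> word_code K w = word_code K w' ->
    word_prod lazy_gen w = word_prod lazy_gen w'}.
  by move=> w w' _ _ gw gw'; apply: word_code_inj; rewrite leq_add2r leq_pmul2l.
move=> /(_ inj) {inj}.
set N := \sum_(w <- _) _; set c := coincidences _ _ _.
have -> : #|{: {ffun 'I_K -> option block} * {ffun V -> V}}| =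
    (#|{: option block}| ^ (2 * l + 18 * 8 ^ n) * #|{: {ffun V -> V}}|)%N.
  rewrite card_prod card_ffun card_ord; congr (_ ^ _ * _)%N.
  by rewrite /K /T card_tuple card_ord; lia.
have NT : N + (T%:R)^-1 * \sum_(w <- words (option 'I_4) m) (crossings w)%:R >= 5 ^+ m.
  have -> : 5 ^+ m = \sum_(w <- words (option 'I_4) m) (1 : R).
    by rewrite big_const_seq count_predT size_words iter_addr_0 card_option card_ord natrX.
  rewrite mulr_sumr -big_split; apply: ler_sum => w _ /=.
  rewrite /good; case: leqP => [_|Tw]; first by rewrite lerDl mulr_ge0 // invr_ge0.
  rewrite add0r mulrC ler_pdivlMr ?mul1r ?ler_nat ?(ltnW Tw) //.
  by rewrite ltr0n /T; have := expn_gt0 8 n; lia.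
have T0 : 0 < T%:R :> R by rewrite ltr0n /T; have := expn_gt0 8 n; lia.
have Hc := sum_crossings m.
have half : (T%:R)^-1 * \sum_(w <- words (option 'I_4) m) (crossings w)%:R <= 5 ^+ m / 2 :> R.
  rewrite mulrC ler_pdivrMr //.
  have : m%:R * energy <= l%:R.
    by rewrite natrM mulrAC -[leRHS]mul1r ler_wpM2r.
  have TE : T%:R = l%:R + 8 * 8 ^+ n :> R by rewrite natrD natrM natrX.
  have e5 : 0 <= 5 ^+ m :> R by rewrite exprn_ge0.
  have l0 : 0 <= l%:R :> R by [].
  rewrite TE => me; move: Hc; move: e5 me l0.
  move: (5 ^+ m) (m%:R * energy) (8 ^+ n) (\sum_(_ <- _) _) (l%:R) => x y z s t.
  by move=> *; nra.
have N2 : 5 ^+ m / 2 <= N.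
  rewrite -(lerD2r (5 ^+ m / 2)) -splitr; apply: le_trans NT _.
  by rewrite lerD2l.
move=> H; have x0 : 0 <= 5 ^+ m / 2 :> R by rewrite divr_ge0 ?exprn_ge0.
have := le_trans (lerXn2r 2 _ _ N2) H; rewrite !nnegrE x0 (le_trans x0 N2).
move=> /(_ isT isT); rewrite natrM natrX exprD exprM.
rewrite expr_div_n => H2.
rewrite (_ : 4 * (_ * _) * _ * c = 4 * ((#|{: option block}|%:R ^+ 2) ^+ l *
  #|{: option block}|%:R ^+ (18 * 8 ^ n) * #|{: {ffun V -> V}}|%:R * c)); last by ring.
rewrite -ler_pdivrMl //; apply: le_trans H2.
by rewrite mulrC (_ : 2 ^+ 2 = 4 :> R) //; ring.
Qed.

End Code.

(** * Decay of the energy and conclusion *)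

Lemma energy_small (R : realType) q : exists2 n, (0 < n)%N & q%:R * energy n R <= 1.
Proof.
have q1 : 0 < q%:R + 1 :> R by rewrite ltr_wpDl.
have [||k kP] := @expr_small R (1 / 9) (20 * (q%:R + 1))^-1.
- by apply/andP; split; lra.
- by rewrite invr_gt0 mulr_gt0.
exists k.+1 => //; have T0 : 0 < (3 ^ k.+1).-1%:R ^+ 2 :> R.
  by rewrite exprn_gt0 // top_gt0.
rewrite /energy [_ * (_ / _)]mulrA ler_pdivrMr // mul1r.
(* This gives the bound [20 * (8 / 9) ^ n] for the energy at [n = k.+1]. *)
have T3 : 3 ^+ k.+1 <= 2 * (3 ^ k.+1).-1%:R :> R.
  by rewrite -natrX -natrM ler_nat expnS; have := expn_gt0 3 k; lia.
have {}T3 : 9 ^+ k.+1 <= 4 * (3 ^ k.+1).-1%:R ^+ 2 :> R.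
  have -> : 9 = 3 ^+ 2 :> R by ring.
  have x0 : 0 <= 3 ^+ k.+1 :> R by rewrite exprn_ge0.
  rewrite exprAC -(mulr1 4) -[X in X * 1](_ : 2 ^+ 2 = 4 :> R); last by ring.
  by rewrite mulr1 -exprMn lerXn2r // nnegrE (le_trans x0).
have E8 : 8 ^+ k.+1 = (1 - 1 / 9) ^+ k.+1 * 9 ^+ k.+1 :> R.
  by rewrite -exprMn; congr (_ ^+ _); field.
have kP' : (1 - 1 / 9) ^+ k.+1 <= (20 * (q%:R + 1))^-1 :> R.
  apply: le_trans kP; rewrite exprS ler_piMl ?exprn_ge0 //; lra.
have qk : q%:R * (1 - 1 / 9) ^+ k.+1 <= 1 / 20 :> R.
  apply: (@le_trans _ _ (q%:R * (20 * (q%:R + 1))^-1)); first by rewrite ler_wpM2l.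
  by rewrite ler_pdivrMr ?mulr_gt0 //; lra.
have x0 : 0 <= 9 ^+ k.+1 :> R by rewrite exprn_ge0.
have {}qk := ler_wpM2r x0 qk.
have -> : q%:R * (5 * 8 ^+ k.+1) = 5 * (q%:R * (1 - 1 / 9) ^+ k.+1 * 9 ^+ k.+1) :> R.
  by rewrite E8; ring.
apply: le_trans (_ : 5 * (1 / 20 * 9 ^+ k.+1) <= _); first by rewrite ler_wpM2l.
rewrite (_ : 5 * (1 / 20 * 9 ^+ k.+1) = 9 ^+ k.+1 / 4) //; last by field.
by rewrite ler_pdivrMr // mulrC.
Qed.

Theorem carpet_group_amenable (R : realType) : amenable R carpet_group.
Proof.
apply: (kesten_amenable (gen := lazy_gen) (s0 := None)) => //.
  exact: lazy_gen_ind.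
(* The set of blocks is the same for all [n]; the factors that depend on [n], and so on [q], go into
   [C0]. *)
apply: (coincidences_ratio None (C := (#|{: option block}| ^ 2)%N)) => q.
have [n n0 nq] := energy_small R q.
exists (4 * (#|{: option block}| ^ (18 * 8 ^ n) * #|{: {ffun n.-tuple X -> n.-tuple X}}|))%N.
move=> l; have := coincidences_lower n0 l nq.
have -> : #|{: option 'I_4}| = 5%N by rewrite card_option card_ord.
by rewrite !natrM !natrX.
Qed.

Theorem theorem6p5 (R : realType) :
  amenable R carpet_group /\ property_FW carpet_group.
Proof. by split; [apply: carpet_group_amenable | apply: carpet_group_FW]. Qed.
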